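(* Consider a pairwise separable convex program with graph $(V,E)$ and objective $F:\mathbb{R}^V\to\mathbb{R}$, and suppose that $F$ is $(\lambda,w)$-scaled diagonally dominant. Assume that the initial messages $\{J^{(0)}_{i\to j}(\cdot)\}_{(i,j)\in\vec E}$ satisfy the initialization assumption stated in the context. Let the messages evolve according to the asynchronous min-sum algorithm with update time sets $T^i$ and delays $\tau_{u\to i}(t)$ satisfying the total asynchronism assumption stated in the context. Then the estimates of the asynchronous min-sum algorithm converge to the optimal solution: $\lim_{t\to\infty}x^{(t)}=x^*$.
   Context: **Pairwise separable convex program.** Let $(V,E)$ be a finite undirected graph, $V=\{1,\dots,n\}$. The problem is to minimize $$F(x)=\sum_{i\in V}f_i(x_i)+\sum_{(i,j)\in E}f_{ij}(x_i,x_j)$$ over $x\in\mathbb{R}^V$, where each $f_i:\mathbb{R}\to\mathbb{R}$ is strictly convex, coercive and twice continuously differentiable, each $f_{ij}:\mathbb{R}^2\to\mathbb{R}$ is convex and twice continuously differentiable, and $$M:=\min_{i\in V}\inf_{x\in\mathbb{R}^V}\frac{\partial^2}{\partial x_i^2}F(x)>0.$$ There is one factor per undirected edge; $f_{ij}(x_i,x_j)$ and $f_{ji}(x_j,x_i)$ denote the same factor. $x^*\in\mathbb{R}^V$ denotes the unique minimizer of $F$. $N(i)=\{j\in V:(i,j)\in E\}$, and $\vec E=\{(i,j)\in V\times V: i\in N(j)\}$. **Scaled diagonal dominance.** $F$ is $(\lambda,w)$-scaled diagonally dominant if $0<\lambda<1$, $w\in\mathbb{R}^V$ has all components positive, and for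 each $i\in V$ and all $x\in\mathbb{R}^V$, $$\sum_{j\in V\setminus i}w_j\left|\frac{\partial^2}{\partial x_i\partial x_j}F(x)\right|\le\lambda w_i\frac{\partial^2}{\partial x_i^2}F(x).$$ **Initialization assumption.** The initial messages $J^{(0)}_{i\to j}:\mathbb{R}\to\mathbb{R}$ are twice continuously differentiable and for each $(i,j)\in\vec E$ there exists $z_{i\to j}\in\mathbb{R}$ with $$\frac{d^2}{dx_j^2}J^{(0)}_{i\to j}(x_j)\ge\frac{\partial^2}{\partial x_j^2}f_{ij}(z_{i\to j},x_j)\quad\text{for all }x_j\in\mathbb{R}.$$ **Asynchronous min-sum algorithm.** For each $i\in V$, $T^i\subset\{0,1,2,\dots\}$ is the set of times at which vertex $i$ computes new outgoing messages. For $(u,i)\in\vec E$, $\tau_{u\to i}(t)$ is an integer with $0\le\tau_{u\to i}(t)\le t$ (the last time $u$ communicated to $i$). For $(i,j)\in\vec E$, if $t\in T^i$ then $$J^{(t+1)}_{i\to j}(x_j)=\min_{y_i\in\mathbb{R}}\Big(f_i(y_i)+f_{ij}(y_i,x_j)+\sum_{u\in N(i)\setminus j}J^{(\tau_{u\to i}(t))}_{u\to i}(y_i)\Big)+\kappa^{(t+1)}_{i\to j},$$ with $\kappa^{(t+1)}_{i\to j}$ an arbitrary real constant, and $J^{(t+1)}_{i\to j}=J^{(t)}_{i\to j}$ otherwise. The estimates at times $t>0$ are $$b^{(t)}_i(x_i)=f_i(x_i)+\sum_{u\in N(i)}J^{(t)}_{u\to i}(x_i),\qquad x^{(t)}_i=\operatorname{argmin}_{y_i}b^{(t)}_i(y_i).$$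 **Total asynchronism.** Each set $T^i$ is infinite, and if $\{t_k\}$ is a sequence in $T^i$ tending to infinity, then $\lim_{k\to\infty}\tau_{j\to i}(t_k)=\infty$ for each neighbor $j\in N(i)$. *)

(* Defs.v *)
From HB Require Import structures.
From mathcomp Require Import all_boot all_order all_algebra.
From mathcomp Require Import all_classical all_reals all_analysis.

Set Implicit Arguments.
Unset Strict Implicit.
Unset Printing Implicit Defensive.

Import Order.TTheory GRing.Theory Num.Theory.
Import numFieldNormedType.Exports.

Local Open Scope ring_scope.
Local Open Scope classical_set_scope.

Definition simple_graph (n : nat) (e : rel 'I_n) : Prop :=
  symmetric e /\ irreflexive e.

Definition C2_real (R : realType) (f : R -> R) : Prop :=
  [/\ forall x, derivable f x 1,
      forall x, derivable f^`() x 1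
    & continuous (f^`()^`())].

(* The partial derivatives of a function on R * R are its directional
   derivatives along (1, 0) and (0, 1). *)
Definition dir1 (R : realType) : R * R := (1, 0).
Definition dir2 (R : realType) : R * R := (0, 1).

Definition C2_plane (R : realType) (f : R * R -> R) : Prop :=
  continuous f /\
  forall u, u \in [:: dir1 R; dir2 R] ->
    [/\ forall p, derivable f p u,
        continuous ('D_u f)
      & forall v, v \in [:: dir1 R; dir2 R] ->
          (forall p, derivable ('D_u f) p v) /\ continuous ('D_v ('D_u f))].

Definition strictly_convex (R : realType) (f : R -> R) : Prop :=
  forall x y t : R, x != y -> 0 < t < 1 ->
    f (t * x + (1 - t) * y) < t * f x + (1 - t) * f y.

Definition coercive (R : realType) (f : R -> R) : Prop :=
  (f x @[x --> +oo] --> +oo) /\ (f x @[x --> -oo] --> +oo).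

Definition unique_minimizer (R : realType) (T : eqType) (g : T -> R) (y : T)
  : Prop := forall z, z != y -> g y < g z.

(* [f2 i j (a, b)] is the factor of the edge {i, j} at x_i = a, x_j = b;
   restricting to i < j counts each undirected edge once. *)
Definition objective (R : realType) (n : nat) (e : rel 'I_n)
    (f1 : 'I_n -> R -> R) (f2 : 'I_n -> 'I_n -> R * R -> R) (x : 'rV[R]_n) : R :=
  \sum_(i < n) f1 i (x ord0 i) +
  \sum_(i < n) \sum_(j < n | (i < j)%N && e i j) f2 i j (x ord0 i, x ord0 j).

Definition partial2 (R : realType) (n : nat) (F : 'rV[R]_n -> R)
    (i j : 'I_n) (x : 'rV[R]_n) : R :=
  'D_(delta_mx ord0 i) ('D_(delta_mx ord0 j) F) x.

(* Extended-real valued, so that an infimum over an unbounded set is not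
   assigned an arbitrary value. *)
Definition min_curvature (R : realType) (n : nat) (F : 'rV[R]_n -> R) : \bar R :=
  \big[Order.min/+oo%E]_(i < n)
     ereal_inf [set (partial2 F i i x)%:E | x in [set: 'rV[R]_n]].

Record pairwise_separable_convex (R : realType) (n : nat) (e : rel 'I_n)
    (f1 : 'I_n -> R -> R) (f2 : 'I_n -> 'I_n -> R * R -> R) : Prop := {
  psc_vertex : forall i,
    [/\ strictly_convex (f1 i), coercive (f1 i) & C2_real (f1 i)];
  psc_edge : forall i j, e i j ->
    convex_function [set: R * R] (f2 i j) /\ C2_plane (f2 i j);
  psc_factor_sym : forall i j, e i j ->
    forall a b : R, f2 i j (a, b) = f2 j i (b, a);
  psc_curvature : (0 < min_curvature (objective e f1 f2))%E
}.

Definition scaled_diagonally_dominant (R : realType) (n : nat)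
    (lambda : R) (w : 'rV[R]_n) (F : 'rV[R]_n -> R) : Prop :=
  [/\ 0 < lambda < 1,
      forall i, 0 < w ord0 i
    & forall i x, \sum_(j < n | j != i) w ord0 j * `|partial2 F i j x|
                  <= lambda * w ord0 i * partial2 F i i x].

(* Messages are [J i j : R -> R], where [J i j] is sent by i to j; only the
   values at pairs with [e i j] are meaningful. *)
Definition initialization (R : realType) (n : nat) (e : rel 'I_n)
    (f2 : 'I_n -> 'I_n -> R * R -> R) (J0 : 'I_n -> 'I_n -> R -> R) : Prop :=
  forall i j, e i j ->
    C2_real (J0 i j) /\
    exists z : R, forall x : R,
      'D_(dir2 R) ('D_(dir2 R) (f2 i j)) (z, x) <= (J0 i j)^`()^`() x.

Definition local_objective (R : realType) (n : nat) (e : rel 'I_n)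
    (f1 : 'I_n -> R -> R) (f2 : 'I_n -> 'I_n -> R * R -> R)
    (Jin : 'I_n -> R -> R) (i j : 'I_n) (x y : R) : R :=
  f1 i y + f2 i j (y, x) + \sum_(u < n | e i u && (u != j)) Jin u y.

(* The minimum over y is written as an infimum so that its attainment is not
   built into the assumption that the messages follow the algorithm. *)
Definition async_min_sum (R : realType) (n : nat) (e : rel 'I_n)
    (f1 : 'I_n -> R -> R) (f2 : 'I_n -> 'I_n -> R * R -> R)
    (T : 'I_n -> set nat) (tau : 'I_n -> 'I_n -> nat -> nat)
    (kappa : nat -> 'I_n -> 'I_n -> R)
    (J : nat -> 'I_n -> 'I_n -> R -> R) : Prop :=
  forall t i j, e i j ->
    (T i t -> forall x : R,
       J t.+1 i j x =
         inf (range (local_objective e f1 f2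
                       (fun u => J (tau u i t) u i) i j x))
         + kappa t.+1 i j) /\
    (~ T i t -> J t.+1 i j = J t i j).

Definition delays_causal (n : nat) (e : rel 'I_n)
    (tau : 'I_n -> 'I_n -> nat -> nat) : Prop :=
  forall u i, e u i -> forall t, (tau u i t <= t)%N.

Definition totally_asynchronous (n : nat) (e : rel 'I_n)
    (T : 'I_n -> set nat) (tau : 'I_n -> 'I_n -> nat -> nat) : Prop :=
  forall i, infinite_set (T i) /\
    forall s : nat -> nat, (forall k, T i (s k)) ->
      s k @[k --> \oo] --> \oo ->
      forall j, e i j -> tau j i (s k) @[k --> \oo] --> \oo.

Definition belief (R : realType) (n : nat) (e : rel 'I_n)
    (f1 : 'I_n -> R -> R) (J : 'I_n -> 'I_n -> R -> R) (i : 'I_n) (y : R) : R :=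
  f1 i y + \sum_(u < n | e i u) J u i y.

(* Main.v *)
Require Import Defs.
From HB Require Import structures.
From mathcomp Require Import all_boot all_order all_algebra.
From mathcomp Require Import ring lra.
From mathcomp Require Import all_classical all_reals all_analysis.

Set Implicit Arguments.
Unset Strict Implicit.
Unset Printing Implicit Defensive.

Import Order.TTheory GRing.Theory Num.Theory.
Import numFieldNormedType.Exports.

Local Open Scope ring_scope.
Local Open Scope classical_set_scope.

(* Write a message from u to i, differentiated, as d_2 f_ui (g y, y), where g y
   is the value of x_u chosen by u when x_i = y.  Diagonal dominance makes every
   such g Lipschitz with constant lambda * w_u / w_i, and this bound is
   reproduced by an update: compare the stationarity equations of node i at two
   points and apply the mean value theorem to d_i F on the segment joining them,
   so that all second derivatives are taken at one point of R^V.  The bound also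
   makes the function minimized by node i strongly convex.

   The same comparison with a zero x^* of the gradient of F shows that, if
   lambda < q < 1, an update turns
     |g y - x^*_u| / w_u <= max(eps, q |y - x^*_i| / w_i)
   for all incoming messages into the same inequality with q * eps for the
   outgoing one.  With the maximum in place of a sum, the reaction of the
   neighbours of i to x_i itself does not degrade the rate.  Total asynchronism
   allows infinitely many rounds of this contraction.  The point x^* is obtained
   from the Jacobi iteration and minimizes F by convexity. *)

(** * Calculus on the line and in the plane *)

Section LineCalculus.
Variables (R : realType) (V : normedModType R).
Implicit Types (f : V -> R) (a v : V).

(** Both difference quotients are the same function of the increment, which brings directional
    derivatives under one-variable theorems. *)
Lemma is_derive_line f a v s d :
  is_derive (s *: v + a) v f d <-> is_derive s 1 (fun h : R => f (h *: v + a)) d.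
Proof.
have E : (fun h : R => h^-1 *: ((f \o shift (s *: v + a)) (h *: v)
             - f (s *: v + a)))
  = (fun h => h^-1 *: (((fun h : R => f (h *: v + a)) \o shift s) (h *: 1)
             - f (s *: v + a))).
  by apply: funext => h /=; rewrite [h *: 1]mulr1 scalerDl addrA.
by split=> -[D1 D2]; split; move: D1 D2; rewrite /derivable /derive E.
Qed.

Lemma is_derive_eps f a v d :
  (forall e : R, 0 < e -> exists2 r : R, 0 < r & forall h : R, h != 0 ->
     `|h| < r -> `|h^-1 * (f (h *: v + a) - f a) - d| <= e) ->
  is_derive a v f d.
Proof.
move=> H.
have C : (fun h : R => h^-1 *: ((f \o shift a) (h *: v) - f a)) @ 0^' --> d.
  apply/cvgrPdist_le => e /H[r r0 Hr].
  rewrite near_withinE; apply/nbhs_ballP; exists r => //= h.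
  rewrite /ball /= sub0r normrN => hr h0.
  by rewrite distrC; apply: Hr.
by split; [apply/cvg_ex; exists d | exact: cvg_lim C].
Qed.

Lemma is_derive_lim f a v d (e : R) : is_derive a v f d -> 0 < e ->
  exists2 r : R, 0 < r & forall h : R, h != 0 ->
     `|h| < r -> `|h^-1 * (f (h *: v + a) - f a) - d| < e.
Proof.
move=> [/cvg_ex[l Hl] D2] e0.
have E : l = d by rewrite -D2; apply/esym; exact: cvg_lim Hl.
move/cvgrPdist_lt : Hl => /(_ _ e0).
rewrite near_withinE => /nbhs_ballP[r /= r0 Hr]; exists r => // h h0 hr.
rewrite distrC -E; apply: Hr => //.
by rewrite /ball /= sub0r normrN.
Qed.

End LineCalculus.

Section RealCalculus.
Variable R : realType.

Lemma is_derive1_continuous (f df : R -> R) :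
  (forall y : R, is_derive y 1 f (df y)) -> continuous f.
Proof.
move=> Df y; apply/differentiable_continuous/derivable1_diffP.
by have [] := Df y.
Qed.

(** The signed step [h] and the parameter [s] spare later uses a case distinction on the sign of
    [h]. *)
Lemma MVT_step (f df : R -> R) (x h : R) :
  (forall y : R, is_derive y 1 f (df y)) ->
  exists2 s, 0 <= s <= 1 & f (x + h) - f x = h * df (x + s * h).
Proof.
move=> Df.
have cf (a b : R) : {within `[a, b], continuous f}.
  by apply: continuous_subspaceT; exact: is_derive1_continuous Df.
have Df' (a b y : R) : y \in `]a, b[%R -> is_derive y 1 f (df y) by move=> _.
have [h0|h0|->] := ltgtP h 0; last first.
- by exists 0; rewrite ?lexx ?ler01// addr0 subrr mul0r.
- have xh : x < x + h by lra.
  have [c + E] := MVT xh (@Df' _ _) (cf _ _).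
  rewrite in_itv /= => /andP[c1 c2].
  exists ((c - x) / h); first by rewrite ler_pdivlMr// ler_pdivrMr//; lra.
  rewrite E mulfVK ?gt_eqF// [x + (_ - _)]addrC subrK; ring.
- have xh : x + h < x by lra.
  have [c + E] := MVT xh (@Df' _ _) (cf _ _).
  rewrite in_itv /= => /andP[c1 c2].
  exists ((c - x) / h); first by rewrite ler_ndivlMr// ler_ndivrMr//; lra.
  rewrite mulfVK ?lt_eqF// [x + (_ - _)]addrC subrK.
  have -> : f (x + h) - f x = - (f x - f (x + h)) by lra.
  rewrite E; ring.
Qed.

Lemma norm_step_le (s x h : R) : 0 <= s <= 1 -> `|x + s * h - x| <= `|h|.
Proof.
move=> /andP[s0 s1]; rewrite [x + _]addrC addrK normrM (ger0_norm s0).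
by rewrite ler_piMl.
Qed.

Lemma dist_le_of_mid (x a b e : R) :
  `|x - a| < e / 2 -> `|x - b| < e / 2 -> `|a - b| <= e.
Proof.
rewrite !ltr_norml ler_norml => /andP[? ?] /andP[? ?].
by apply/andP; split; lra.
Qed.

(** Division by [h] places the quotient between [A] and [B], in an order that depends on the sign of
    [h]. *)
Lemma quotient_near (h W A B D e : R) : h != 0 ->
  W <= h * A -> h * B <= W -> `|A - D| < e -> `|B - D| < e ->
  `|h^-1 * W - D| <= e.
Proof.
move=> h0 WA BW; rewrite !ltr_norml ler_norml => /andP[? ?] /andP[? ?].
have [hp|hn] := ltP 0 h.
  have q1 : h^-1 * W <= A by rewrite ler_pdivrMl.
  have q2 : B <= h^-1 * W by rewrite ler_pdivlMl.
  by apply/andP; split; lra.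
have {}hn : h < 0 by rewrite lt_neqAle h0.
have q1 : A <= h^-1 * W by rewrite ler_ndivlMl.
have q2 : h^-1 * W <= B by rewrite ler_ndivrMl.
by apply/andP; split; lra.
Qed.

End RealCalculus.

Section LineMVT.
Variables (R : realType) (V : normedModType R).

Lemma MVT_line (f df : V -> R) (a v : V) :
  (forall p, is_derive p v f (df p)) ->
  exists2 s : R, 0 <= s <= 1 & f (v + a) - f a = df (s *: v + a).
Proof.
move=> Df.
have [s s01 E] := @MVT_step R (fun h => f (h *: v + a)) (fun h => df (h *: v + a)) 0 1
  (fun y => (is_derive_line f a v y _).1 (Df _)).
exists s => //; move: E; rewrite add0r scale1r scale0r add0r mul1r => ->.
by rewrite mulr1 add0r.
Qed.

End LineMVT.

Section PlaneCalculus.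
Variable R : realType.
Implicit Types (f : R * R -> R) (p : R * R).

Lemma continuous_plane_eps f p (e : R) : continuous f -> 0 < e ->
  exists2 r : R, 0 < r & forall q : R * R, `|q.1 - p.1| < r -> `|q.2 - p.2| < r ->
    `|f q - f p| < e.
Proof.
move=> cf e0; have /cvgrPdist_lt/(_ _ e0)/nbhs_ballP[r /= r0 Hr] := cf p.
exists r => // q q1 q2; rewrite distrC; apply: Hr; split; rewrite /ball /=.
  by rewrite distrC.
by rewrite distrC.
Qed.

Lemma pair_scaleD (h a b c d : R) :
  h *: ((a, b) : R * R) + (c, d) = (h * a + c, h * b + d).
Proof. by []. Qed.

Lemma is_derive_plane1 f (x b d : R) :
  is_derive (x, b) (dir1 R) f d <-> is_derive x 1 (fun y => f (y, b)) d.
Proof.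
have E h : f (h, b) = f (h *: dir1 R + (0, b)).
  by rewrite pair_scaleD mulr1 mulr0 addr0 add0r.
rewrite (_ : (fun y => f (y, b)) = (fun h => f (h *: dir1 R + (0, b))));
  last exact/funext.
rewrite -is_derive_line (_ : x *: dir1 R + (0, b) = (x, b)) //.
by rewrite pair_scaleD mulr1 mulr0 addr0 add0r.
Qed.

Lemma is_derive_plane2 f (a x d : R) :
  is_derive (a, x) (dir2 R) f d <-> is_derive x 1 (fun y => f (a, y)) d.
Proof.
have E h : f (a, h) = f (h *: dir2 R + (a, 0)).
  by rewrite pair_scaleD mulr1 mulr0 addr0 add0r.
rewrite (_ : (fun y => f (a, y)) = (fun h => f (h *: dir2 R + (a, 0))));
  last exact/funext.
rewrite -is_derive_line (_ : x *: dir2 R + (a, 0) = (a, x)) //.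
by rewrite pair_scaleD mulr1 mulr0 addr0 add0r.
Qed.

Definition C1_plane f :=
  (forall p, derivable f p (dir1 R)) /\ (forall p, derivable f p (dir2 R)) /\
  continuous ('D_(dir1 R) f) /\ continuous ('D_(dir2 R) f).

Lemma is_derive_fst f (x b : R) : (forall p, derivable f p (dir1 R)) ->
  is_derive x 1 (fun y => f (y, b)) ('D_(dir1 R) f (x, b)).
Proof. by move=> D; apply/is_derive_plane1; exact: derivableP. Qed.

Lemma is_derive_snd f (a x : R) : (forall p, derivable f p (dir2 R)) ->
  is_derive x 1 (fun y => f (a, y)) ('D_(dir2 R) f (a, x)).
Proof. by move=> D; apply/is_derive_plane2; exact: derivableP. Qed.

(** The increment is split along two sides of a rectangle parallel to the axes; the mean value
    theorem on each side and continuity of the partial derivatives give the limit. *)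
Lemma C1_plane_is_derive f p (c d : R) : C1_plane f ->
  is_derive p (c, d) f (c * 'D_(dir1 R) f p + d * 'D_(dir2 R) f p).
Proof.
move=> [D1 [D2 [C1 C2]]]; case: p => a b; apply: is_derive_eps => e e0.
(* [K] dominates [|c|], [|d|] and their sum; the summand 1 keeps it positive for the divisions. *)
pose K := `|c| + `|d| + 1.
have K0 : 0 < K by rewrite /K; have := normr_ge0 c; have := normr_ge0 d; lra.
have eK : 0 < e / K by rewrite divr_gt0.
have [r1 r10 H1] := continuous_plane_eps (a, b) C1 eK.
have [r2 r20 H2] := continuous_plane_eps (a, b) C2 eK.
exists (Num.min r1 r2 / K); first by rewrite divr_gt0// lt_min r10.
move=> h h0; rewrite ltr_pdivlMr// lt_min => /andP[hr1 hr2].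
have [s s01 E1] := MVT_step a (h * c) (fun y => is_derive_fst y (b + h * d) D1).
have [t t01 E2] := MVT_step b (h * d) (fun y => is_derive_snd a y D2).
have -> : h *: (c, d) + (a, b) = (a + h * c, b + h * d).
  by rewrite pair_scaleD ![h * _ + _]addrC.
have -> : f (a + h * c, b + h * d) - f (a, b) =
  h * c * 'D_(dir1 R) f (a + s * (h * c), b + h * d) +
  h * d * 'D_(dir2 R) f (a, b + t * (h * d)) by rewrite -E1 -E2; lra.
set A := 'D_(dir1 R) f (_ + _, _); set B := 'D_(dir2 R) f (_, _ + _).
set A0 := 'D_(dir1 R) f _; set B0 := 'D_(dir2 R) f _.
have hb (x s' : R) : `|x| <= K -> 0 <= s' <= 1 -> `|s' * (h * x)| <= `|h| * K.
  move=> xK /andP[s0 s1]; rewrite !normrM (ger0_norm s0).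
  apply: (@le_trans _ _ (1 * (`|h| * `|x|))); first by rewrite ler_wpM2r.
  by rewrite mul1r ler_wpM2l.
have cK : `|c| <= K by rewrite /K; have := normr_ge0 d; lra.
have dK : `|d| <= K by rewrite /K; have := normr_ge0 c; lra.
have hA : `|A - A0| < e / K.
  apply: H1 => /=; rewrite addrC addKr; apply: le_lt_trans hr1.
    exact: hb.
  by have := hb d 1 dK; rewrite mul1r; apply; rewrite ler01 lexx.
have hB : `|B - B0| < e / K.
  apply: H2 => /=; rewrite ?subrr ?normr0 // addrC addKr.
  by apply: le_lt_trans hr2; exact: hb.
clearbody A B A0 B0.
have -> : h^-1 * (h * c * A + h * d * B) - (c * A0 + d * B0)
  = c * (A - A0) + d * (B - B0) by field.
rewrite (le_trans (ler_normD _ _))// !normrM.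
apply: (@le_trans _ _ (`|c| * (e / K) + `|d| * (e / K))).
  by apply: lerD; rewrite ler_wpM2l// ltW.
rewrite -mulrDl mulrCA -[leRHS]mulr1 ler_wpM2l//; first exact: ltW.
by rewrite ler_pdivrMr// mul1r /K; lra.
Qed.

Lemma C2_planeW f : C2_plane f ->
  [/\ continuous f, C1_plane f, C1_plane ('D_(dir1 R) f) & C1_plane ('D_(dir2 R) f)].
Proof.
move=> [cf H].
have d1 : dir1 R \in [:: dir1 R; dir2 R] by rewrite !inE eqxx.
have d2 : dir2 R \in [:: dir1 R; dir2 R] by rewrite !inE eqxx orbT.
have [a1 b1 c1] := H _ d1; have [a2 b2 c2] := H _ d2.
have [e11 e11'] := c1 _ d1; have [e12 e12'] := c1 _ d2.
have [e21 e21'] := c2 _ d1; have [e22 e22'] := c2 _ d2.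
split; [exact: cf|..]; split; [exact: a1|split; [exact: a2|split]; [exact: b1|exact: b2]
  |exact: e11|split; [exact: e12|split]; [exact: e11'|exact: e12']
  |exact: e21|split; [exact: e22|split]; [exact: e21'|exact: e22']].
Qed.

(** Schwarz's theorem: the second difference of [f] over a small square of side [h] is [h^2] times
    either mixed derivative at some point of the square, depending on the order in which the
    differences are taken. *)
Lemma derive_plane_comm f p : C2_plane f ->
  'D_(dir1 R) ('D_(dir2 R) f) p = 'D_(dir2 R) ('D_(dir1 R) f) p.
Proof.
move=> /C2_planeW[_ [D1 [D2 _]] [_ [D21 [_ C21]]] [D12 [_ [C12 _]]]].
case: p => a b; apply/eqP; rewrite -subr_eq0 -normr_le0.
apply/ler_addgt0Pr => e e0; rewrite add0r.
have e2 : 0 < e / 2 by rewrite divr_gt0.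
have [r1 r10 H1] := continuous_plane_eps (a, b) C12 e2.
have [r2 r20 H2] := continuous_plane_eps (a, b) C21 e2.
pose h := Num.min r1 r2 / 2.
have h0 : 0 < h by rewrite divr_gt0// lt_min r10.
have hr1 : h < r1.
  have m1 : Num.min r1 r2 <= r1 by rewrite ge_min lexx.
  by rewrite /h in h0 *; lra.
have hr2 : h < r2.
  have m2 : Num.min r1 r2 <= r2 by rewrite ge_min lexx orbT.
  by rewrite /h in h0 *; lra.
clearbody h.
have d1 (y : R) : is_derive y 1 (fun x => f (x, b + h) - f (x, b))
    ('D_(dir1 R) f (y, b + h) - 'D_(dir1 R) f (y, b)).
  by apply: is_deriveB; exact: is_derive_fst.
have d2 (y : R) : is_derive y 1 (fun x => f (a + h, x) - f (a, x))
    ('D_(dir2 R) f (a + h, y) - 'D_(dir2 R) f (a, y)).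
  by apply: is_deriveB; exact: is_derive_snd.
have [s s01 E1] := MVT_step a h d1.
have [t t01 E2] := MVT_step b h d2.
have [s' s01' E1'] := MVT_step b h (fun y => is_derive_snd (a + s * h) y D21).
have [t' t01' E2'] := MVT_step a h (fun y => is_derive_fst y (b + t * h) D12).
move: E1 E2; rewrite {}E1' {}E2' => E1 E2.
have E : 'D_(dir2 R) ('D_(dir1 R) f) (a + s * h, b + s' * h) =
         'D_(dir1 R) ('D_(dir2 R) f) (a + t' * h, b + t * h).
  move: E1 E2; move: ('D_(dir2 R) _ _) ('D_(dir1 R) _ _) => X Y.
  move: (f (_, _)) (f (_, _)) (f (_, _)) (f (_, _)) => u1 u2 u3 u4 E1 E2.
  apply/(mulfI (lt0r_neq0 h0))/(mulfI (lt0r_neq0 h0)).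
  by rewrite -E1 -E2; lra.
have sh (s0 x r : R) : 0 <= s0 <= 1 -> h < r -> `|x + s0 * h - x| < r.
  by move=> s01_; apply: le_lt_trans; rewrite -{2}(gtr0_norm h0); exact: norm_step_le.
have A1 := H1 (a + t' * h, b + t * h) (sh _ _ _ t01' hr1) (sh _ _ _ t01 hr1).
have A2 := H2 (a + s * h, b + s' * h) (sh _ _ _ s01 hr2) (sh _ _ _ s01' hr2).
rewrite E in A2; exact: dist_le_of_mid A1 A2.
Qed.

(* Envelope theorem: the hypothesis says that V is an infimum of functions
   f (y, x) + c y attained at y = g x. *)
Lemma is_derive_envelope f (V g : R -> R) (x : R) :
  (forall p, derivable f p (dir2 R)) -> continuous ('D_(dir2 R) f) ->
  continuous g ->
  (forall x x', V x' - V x <= f (g x, x') - f (g x, x)) ->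
  is_derive x 1 V ('D_(dir2 R) f (g x, x)).
Proof.
move=> D2 C2 cg HV; apply: is_derive_eps => e e0.
have [r r0 Hr] := continuous_plane_eps (g x, x) C2 e0.
have /cvgrPdist_lt/(_ _ r0)/nbhs_ballP[r' /= r'0 Hr'] := cg x.
exists (Num.min r r'); first by rewrite lt_min r0.
move=> h h0; rewrite lt_min => /andP[hr hr'].
rewrite (_ : h *: 1 + x = x + h); last by rewrite [h *: 1]mulr1 addrC.
have [s s01 E1] := MVT_step x h (fun y => is_derive_snd (g x) y D2).
have [t t01 E2] := MVT_step x h (fun y => is_derive_snd (g (x + h)) y D2).
have sh (s0 : R) : 0 <= s0 <= 1 -> `|x + s0 * h - x| < r.
  by move=> s01_; apply: le_lt_trans hr; exact: norm_step_le.
have A1 : `|'D_(dir2 R) f (g x, x + s * h) - 'D_(dir2 R) f (g x, x)| < e.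
  by apply: Hr => /=; rewrite ?subrr ?normr0//; exact: sh.
have A2 : `|'D_(dir2 R) f (g (x + h), x + t * h) - 'D_(dir2 R) f (g x, x)| < e.
  apply: Hr => /=; last exact: sh.
  rewrite distrC; apply: Hr'; rewrite /ball /= opprD addrA subrr add0r normrN; exact: hr'.
(* [HV] from [x] to [x + h] bounds the increment of [V] above; from [x + h] back to [x] it bounds it
   below. *)
apply: quotient_near h0 _ _ A1 A2.
  by rewrite -E1; exact: HV.
by rewrite -E2 -opprB lerNl opprB; exact: HV.
Qed.

End PlaneCalculus.

(** * Gradient and Hessian of the objective *)

Section Substitution.
Variables (R : realType) (V W : normedModType R).

(** Only the values along the line matter, so derivatives on R^V can be computed on the line or the
    plane. *)
Lemma difference_quotient_along (f : V -> R) (g : W -> R) a v b c :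
  (forall h : R, f (h *: v + a) = g (h *: c + b)) ->
  (fun h : R => h^-1 *: ((f \o shift a) (h *: v) - f a))
  = (fun h => h^-1 *: ((g \o shift b) (h *: c) - g b)).
Proof.
move=> E; have E0 : f a = g b by have := E 0; rewrite !scale0r !add0r.
by apply: funext => h /=; rewrite E E0.
Qed.

Lemma derive_along (f : V -> R) (g : W -> R) a v b c :
  (forall h : R, f (h *: v + a) = g (h *: c + b)) -> 'D_v f a = 'D_c g b.
Proof. by rewrite /derive => /difference_quotient_along ->. Qed.

Lemma is_derive_along (f : V -> R) (g : W -> R) a v b c d :
  (forall h : R, f (h *: v + a) = g (h *: c + b)) ->
  is_derive b c g d -> is_derive a v f d.
Proof.
move=> /[dup] /derive_along E /difference_quotient_along Q [D1 D2].
by split; [move: D1; rewrite /derivable Q | rewrite E].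
Qed.

Lemma is_derive_bigsum (n : nat) (P : pred 'I_n) (f : 'I_n -> V -> R) a v
    (d : 'I_n -> R) :
  (forall i, P i -> is_derive a v (f i) (d i)) ->
  is_derive a v (fun x => \sum_(i < n | P i) f i x) (\sum_(i < n | P i) d i).
Proof.
move=> H; rewrite (_ : (fun x => _) = \sum_(i < n | P i) f i); last first.
  by apply: funext => x; rewrite fct_sumE.
elim/big_ind2 : _ => // [|*]; [exact: is_derive_cst|exact: is_deriveD].
Qed.

End Substitution.

Lemma is_derive_scaled (R : realType) (f : R -> R) (a c d : R) :
  is_derive a 1 f d -> is_derive a c f (c * d).
Proof.
move=> Df; have -> : a = 0 *: c + a by rewrite scale0r add0r.
apply/is_derive_line; rewrite mulrC.
have Dg : is_derive (0 : R) 1 (fun h : R => h * c + a) (c + 0).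
  apply: is_deriveD.
  rewrite (_ : (fun h : R => h * c) = c *: id); last first.
    by apply: funext => h /=; rewrite [RHS]mulrC.
  by rewrite -[X in is_derive _ _ _ X]mulr1; exact: is_deriveZ.
rewrite addr0 in Dg.
have Df' : is_derive (0 * c + a : R) 1 f d by rewrite mul0r add0r.
exact: (@is_derive1_comp R f (fun h => h * c + a) 0 d c).
Qed.

Lemma derive_swap (R : realType) (f g : R * R -> R) (a b c d : R) :
  (forall x y, f (x, y) = g (y, x)) ->
  'D_(c, d) f (a, b) = 'D_(d, c) g (b, a).
Proof.
by move=> E; apply: derive_along => h; rewrite !pair_scaleD.
Qed.

Section EdgeSums.
Variables (R : realType) (n : nat) (e : rel 'I_n).
Hypothesis e_simple : simple_graph e.

(** Regroups the termwise derivative of [gradient] along [v] by coordinates of [v]; the coefficients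
    become a row of [hessian]. *)
Lemma gradient_variation (i : 'I_n) (v d12 d22 : 'I_n -> R) (d : R) :
  v i * d + \sum_(u < n | e i u) (v u * d12 u + v i * d22 u) =
  \sum_(k < n) v k * (if k == i then d + \sum_(u < n | e i u) d22 u
                      else if e i k then d12 k else 0).
Proof.
rewrite big_split /= addrCA -mulr_sumr -mulrDr [RHS](bigD1 i) //= addrC eqxx.
congr (_ + _); rewrite [LHS]big_mkcond [RHS]big_mkcond /=.
apply: eq_bigr => k _; case: eqVneq => [->|ki] /=; first by rewrite e_simple.2.
by case: ifP; rewrite ?mulr0.
Qed.

(** Each undirected edge, counted once in [objective], contributes to the gradient at both of its
    endpoints. *)
Lemma edge_sum_orient (v d : 'I_n -> R) (A : 'I_n -> 'I_n -> R) :
  \sum_(i < n) v i * (d i + \sum_(u < n | e i u) A u i) =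
  \sum_(i < n) v i * d i +
  \sum_(i < n) \sum_(j < n | (i < j)%N && e i j) (v i * A j i + v j * A i j).
Proof.
have [e_sym e_irr] := e_simple.
under eq_bigr do rewrite mulrDr; rewrite big_split /=; congr (_ + _).
under [RHS]eq_bigr do rewrite big_split /=; rewrite [RHS]big_split /=.
rewrite [X in _ = _ + X](exchange_big_dep xpredT) //= -big_split /=.
apply: eq_bigr => i _.
rewrite mulr_sumr (bigID (fun u : 'I_n => (i < u)%N)) /=; congr (_ + _).
  by apply: eq_bigl => j; rewrite andbC.
apply: eq_bigl => j; rewrite andbC e_sym; case eij : (e j i); rewrite ?andbF //.
rewrite !andbT -leqNgt ltn_neqAle; case: eqP => //= /val_inj ji.
by rewrite ji e_irr in eij.
Qed.

End EdgeSums.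

Section Gradient.
Variables (R : realType) (n : nat) (e : rel 'I_n).
Variables (f1 : 'I_n -> R -> R) (f2 : 'I_n -> 'I_n -> R * R -> R).
Hypothesis e_simple : simple_graph e.
Hypothesis f12 : pairwise_separable_convex e f1 f2.

Let e_sym : symmetric e := e_simple.1.
Let e_irr : irreflexive e := e_simple.2.

(** Node [i] takes the second slot of every factor, so that derivatives in its variable are always
    along [dir2], as in the messages. *)
Definition gradient (i : 'I_n) (x : 'rV[R]_n) : R :=
  derive1 (f1 i) (x ord0 i) +
  \sum_(u < n | e i u) 'D_(dir2 R) (f2 u i) (x ord0 u, x ord0 i).

Definition hessian (i k : 'I_n) (x : 'rV[R]_n) : R :=
  if k == i then derive1 (derive1 (f1 i)) (x ord0 i) +
    \sum_(u < n | e i u) 'D_(dir2 R) ('D_(dir2 R) (f2 u i)) (x ord0 u, x ord0 i)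
  else if e i k then 'D_(dir1 R) ('D_(dir2 R) (f2 k i)) (x ord0 k, x ord0 i)
  else 0.

Lemma edge_C1 u i : e i u -> C1_plane (f2 u i).
Proof.
by rewrite e_sym => /(psc_edge f12)[_ /C2_planeW[]].
Qed.

Lemma edge_C1_derive u i : e i u -> C1_plane ('D_(dir2 R) (f2 u i)).
Proof.
by rewrite e_sym => /(psc_edge f12)[_ /C2_planeW[]].
Qed.

Lemma is_derive_coord (f : R -> R) (i : 'I_n) (x v : 'rV[R]_n) d :
  is_derive (x ord0 i) 1 f d ->
  is_derive x v (fun y : 'rV[R]_n => f (y ord0 i)) (v ord0 i * d).
Proof.
move=> /(is_derive_scaled (v ord0 i)); apply: is_derive_along => h.
by rewrite !mxE.
Qed.

Lemma is_derive_coord2 (f : R * R -> R) (i j : 'I_n) (x v : 'rV[R]_n) :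
  C1_plane f ->
  is_derive x v (fun y : 'rV[R]_n => f (y ord0 i, y ord0 j))
    (v ord0 i * 'D_(dir1 R) f (x ord0 i, x ord0 j) +
     v ord0 j * 'D_(dir2 R) f (x ord0 i, x ord0 j)).
Proof.
move=> Cf; apply: is_derive_along (C1_plane_is_derive _ _ _ Cf) => h.
by rewrite !mxE pair_scaleD.
Qed.

Lemma is_derive_gradient i x v :
  is_derive x v (gradient i) (\sum_(k < n) v ord0 k * hessian i k x).
Proof.
have [_ _ [_ D _]] := psc_vertex f12 i.
have H1 : is_derive x v (fun y : 'rV[R]_n => derive1 (f1 i) (y ord0 i))
    (v ord0 i * derive1 (derive1 (f1 i)) (x ord0 i)).
  by apply: is_derive_coord; rewrite derive1E; exact: derivableP.
have H2 := is_derive_bigsum (fun u (eiu : e i u) =>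
  is_derive_coord2 u i x v (edge_C1_derive eiu)).
have := is_deriveD H1 H2; congr is_derive.
exact: gradient_variation.
Qed.

Lemma edge_swap i j (a b : R) : e i j ->
  'D_(dir2 R) (f2 j i) (a, b) = 'D_(dir1 R) (f2 i j) (b, a).
Proof.
by move=> eij; apply: derive_swap => x y; rewrite (psc_factor_sym f12) // e_sym.
Qed.

Lemma is_derive_objective x v :
  is_derive x v (objective e f1 f2) (\sum_(i < n) v ord0 i * gradient i x).
Proof.
have H1 : is_derive x v (fun y : 'rV[R]_n => \sum_(i < n) f1 i (y ord0 i))
    (\sum_(i < n) v ord0 i * derive1 (f1 i) (x ord0 i)).
  apply: is_derive_bigsum => i _; have [_ _ [D _ _]] := psc_vertex f12 i.
  by apply: is_derive_coord; rewrite derive1E; exact: derivableP.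
have H2 : is_derive x v (fun y : 'rV[R]_n =>
      \sum_(i < n) \sum_(j < n | (i < j)%N && e i j) f2 i j (y ord0 i, y ord0 j))
    (\sum_(i < n) \sum_(j < n | (i < j)%N && e i j)
      (v ord0 i * 'D_(dir1 R) (f2 i j) (x ord0 i, x ord0 j) +
       v ord0 j * 'D_(dir2 R) (f2 i j) (x ord0 i, x ord0 j))).
  apply: is_derive_bigsum => i _; apply: is_derive_bigsum => j /andP[_ eij].
  by apply: is_derive_coord2; apply: edge_C1; rewrite e_sym.
have := is_deriveD H1 H2; congr is_derive.
rewrite (edge_sum_orient e_simple (fun i => v ord0 i)
  (fun i => derive1 (f1 i) (x ord0 i))
  (fun u i => 'D_(dir2 R) (f2 u i) (x ord0 u, x ord0 i))).
congr (_ + _); apply: eq_bigr => i _; apply: eq_bigr => j /andP[_ eij].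
by rewrite (edge_swap _ _ eij).
Qed.

Lemma sum_delta (k : 'I_n) (c : 'I_n -> R) :
  \sum_(i < n) (delta_mx ord0 k : 'rV[R]_n) ord0 i * c i = c k.
Proof.
rewrite (bigD1 k) //= big1 => [|i /negPf ik]; rewrite mxE ?eqxx ?ik ?mul0r //.
by rewrite mul1r addr0.
Qed.

Lemma partial2_objective i k x :
  partial2 (objective e f1 f2) i k x = hessian k i x.
Proof.
rewrite /partial2 (_ : 'D_(delta_mx ord0 k) (objective e f1 f2) = gradient k).
  by have [_ ->] := is_derive_gradient k x (delta_mx ord0 i); rewrite sum_delta.
apply: funext => y.
by have [_ ->] := is_derive_objective y (delta_mx ord0 k); rewrite sum_delta.
Qed.

(** Factor symmetry expresses both entries through [f2 i k], where Schwarz's theorem applies. *)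
Lemma hessian_sym i k x : hessian i k x = hessian k i x.
Proof.
rewrite /hessian eq_sym; case: eqVneq => [-> //|_]; rewrite e_sym.
case eki : (e k i); last by [].
have eik : e i k by rewrite e_sym.
have C := (psc_edge f12 eik).2.
apply: (etrans _ (esym (derive_plane_comm _ C))).
by apply: derive_swap => a b; exact: edge_swap.
Qed.

Lemma hessian_dominant lambda w i x :
  scaled_diagonally_dominant lambda w (objective e f1 f2) ->
  \sum_(k < n | k != i) w ord0 k * `|hessian i k x|
    <= lambda * w ord0 i * hessian i i x.
Proof.
move=> [_ _ /(_ i x)]; rewrite partial2_objective.
by under eq_bigr do rewrite partial2_objective hessian_sym.
Qed.

(** The infimum is an extended real; the value at 0 excludes [+oo], so a positive real bound
    remains. *)
Lemma hessian_curvature i : exists2 M : R, 0 < M & forall x, M <= hessian i i x.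
Proof.
have := psc_curvature f12; rewrite /min_curvature => H.
have {H} : (0 < ereal_inf [set (partial2 (objective e f1 f2) i i x)%:E
    | x in [set: 'rV[R]_n]])%E.
  by apply: lt_le_trans H _; rewrite (bigD1 i) //= ge_min lexx.
case E : (ereal_inf _) => [m||] // m0; last first.
  have : (ereal_inf [set (partial2 (objective e f1 f2) i i x)%:E
      | x in [set: 'rV[R]_n]] <= (partial2 (objective e f1 f2) i i 0)%:E)%E.
    by apply: ereal_inf_lbound; exists 0.
  by rewrite E.
exists m => // x; rewrite -partial2_objective -lee_fin -E.
by apply: ereal_inf_lbound; exists x.
Qed.

(** Continuity along curves is the form used by the intermediate value theorem. *)
Lemma gradient_continuous i (P : R -> 'rV[R]_n) :
  (forall k, continuous (fun y => P y ord0 k)) ->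
  continuous (fun y => gradient i (P y)).
Proof.
move=> cP y; apply: cvgD.
  have [_ _ [_ D _]] := psc_vertex f12 i.
  apply: (continuous_comp (cP i y)).
  exact/differentiable_continuous/derivable1_diffP.
apply: cvg_big => [|u eiu]; first exact: add_continuous.
have [_ [_ [_ c2]]] := edge_C1 eiu.
apply: (@continuous_comp _ _ _ (fun y => (P y ord0 u, P y ord0 i))
  ('D_(dir2 R) (f2 u i))); last exact: c2.
exact: cvg_pair (cP u y) (cP i y).
Qed.

End Gradient.

(** * Diagonally dominant systems *)

Section StronglyMonotone.
Variables (R : realType) (b psi : R -> R) (c : R).
Hypothesis c_gt0 : 0 < c.
Hypothesis psi_cont : continuous psi.
Hypothesis psi_mono : forall y y', y' <= y -> c * (y - y') <= psi y - psi y'.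

(** Growth at rate [c] forces a change of sign within distance [|psi 0| / c] of 0. *)
Lemma strongly_monotone_zero : exists y, psi y = 0.
Proof.
pose r := `|psi 0| / c.
have r0 : 0 <= r by rewrite divr_ge0// ltW.
have cr : c * r = `|psi 0| by rewrite mulrC divfK ?gt_eqF.
have Nr : - r <= r by lra.
have m1 := psi_mono r0.
have r0' : - r <= 0 by rewrite oppr_le0.
have m2 := psi_mono r0'.
have a1 := ler_norm (psi 0); have a2 := ler_norm (- psi 0); rewrite normrN in a2.
have p1 : 0 <= psi r by lra.
have p2 : psi (- r) <= 0 by lra.
have mm : Num.min (psi (- r)) (psi r) <= 0 <= Num.max (psi (- r)) (psi r).
  by rewrite ge_min p2 le_max p1 orbT.
have [y _ py] := IVT Nr (continuous_subspaceT psi_cont) mm.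
by exists y.
Qed.

Lemma strongly_monotone_minimizer y : (forall z : R, is_derive z 1 b (psi z)) ->
  psi y = 0 -> unique_minimizer b y.
Proof.
move=> Db y0 z zy.
(* The midpoint of y and z makes the inequality strict. *)
pose m := (y + z) / 2.
have [s /andP[s0 s1] E1] := MVT_step y ((z - y) / 2) Db.
have [t /andP[t0 t1] E2] := MVT_step m ((z - y) / 2) Db.
have mE : y + (z - y) / 2 = m by rewrite /m; field.
have zE : m + (z - y) / 2 = z by rewrite /m; field.
rewrite mE in E1; rewrite zE in E2.
have [zy'|zy'] := ltP y z.
- have h0 : 0 < (z - y) / 2 by lra.
  have p1 : 0 <= psi (y + s * ((z - y) / 2)).
    have yy : y <= y + s * ((z - y) / 2) by rewrite lerDl mulr_ge0// ltW.
    have := psi_mono yy; rewrite y0 subr0; apply: le_trans.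
    by rewrite mulr_ge0 ?subr_ge0// ltW.
  have p2 : 0 < psi (m + t * ((z - y) / 2)).
    have yy : y < m + t * ((z - y) / 2).
      by rewrite -mE -addrA ltrDl ltr_pwDl// mulr_ge0// ltW.
    have := psi_mono (ltW yy); rewrite y0 subr0; apply: lt_le_trans.
    by rewrite mulr_gt0// subr_gt0.
  have q1 : 0 <= b m - b y by rewrite E1 mulr_ge0// ltW.
  have q2 : 0 < b z - b m by rewrite E2 mulr_gt0.
  lra.
- have {}zy' : z < y by rewrite lt_neqAle zy.
  have h0 : (z - y) / 2 < 0 by lra.
  have p1 : psi (y + s * ((z - y) / 2)) <= 0.
    have yy : y + s * ((z - y) / 2) <= y by rewrite gerDl mulr_ge0_le0// ltW.
    have := psi_mono yy; rewrite y0 sub0r => H; rewrite -oppr_ge0; apply: le_trans H.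
    by rewrite mulr_ge0 ?subr_ge0// ltW.
  have p2 : psi (m + t * ((z - y) / 2)) < 0.
    have yy : m + t * ((z - y) / 2) < y.
      have := mulr_ge0_le0 t0 (ltW h0); move: (t * _) => X; rewrite -mE; lra.
    have := psi_mono (ltW yy); rewrite y0 sub0r => H.
    rewrite -oppr_gt0; apply: lt_le_trans H.
    by rewrite mulr_gt0// subr_gt0.
  have q1 : 0 <= b m - b y by rewrite E1 mulr_le0// ltW.
  have q2 : 0 < b z - b m by rewrite E2 nmulr_rgt0.
  lra.
Qed.

End StronglyMonotone.

Lemma rV_norm_le (R : realType) n (v : 'rV[R]_n) (r : R) : 0 <= r ->
  (forall i, `|v ord0 i| <= r) -> `|v| <= r.
Proof.
move=> r0 H; rewrite [leLHS]mx_normrE; apply: bigmax_le => // -[i j] _ /=.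
by rewrite ord1.
Qed.

Lemma rV_norm_ge (R : realType) n (v : 'rV[R]_n) i : `|v ord0 i| <= `|v|.
Proof.
by rewrite [leRHS]mx_normrE (le_bigmax _ (fun ij => `|v ij.1 ij.2|) (ord0, i)).
Qed.

(** Completeness of R^n, on which the Banach fixed point theorem rests in
    [critical_point_exists]. *)
HB.instance Definition _ (R : realType) n := Complete.on 'rV[R]_n.

(** * Maps with a diagonally dominant Jacobian *)

Section DominantSystem.
Variables (R : realType) (n : nat) (lambda : R) (w : 'rV[R]_n).
Variables (G : 'I_n -> 'rV[R]_n -> R) (H : 'I_n -> 'I_n -> 'rV[R]_n -> R).
Hypothesis lambda01 : 0 < lambda < 1.
Hypothesis w_gt0 : forall i, 0 < w ord0 i.
Hypothesis G_deriv : forall i x v,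
  is_derive x v (G i) (\sum_(k < n) v ord0 k * H i k x).
Hypothesis G_cont : forall i (P : R -> 'rV[R]_n),
  (forall k, continuous (fun y => P y ord0 k)) -> continuous (fun y => G i (P y)).
Hypothesis H_curv : forall i, exists2 M : R, 0 < M & forall x, M <= H i i x.
Hypothesis H_dom : forall i x,
  \sum_(k < n | k != i) w ord0 k * `|H i k x| <= lambda * w ord0 i * H i i x.

Implicit Types (P Q : 'rV[R]_n).

(** The mean value theorem on the segment from [Q] to [P] evaluates row [i] at one point [x], where
    dominance applies. The factor [H i i x] is kept because it cancels in [sensitivity]. *)
Lemma increment_bound i P Q (d : R) : 0 <= d ->
  (forall k, k != i -> `|P ord0 k - Q ord0 k| <= w ord0 k * d) ->
  exists2 x, 0 < H i i x &
    `|G i P - G i Q - H i i x * (P ord0 i - Q ord0 i)|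
      <= lambda * w ord0 i * H i i x * d.
Proof.
move=> d0 PQ.
have [s _ E] := MVT_line Q (v := P - Q) (fun p => G_deriv i p (P - Q)).
rewrite subrK in E; rewrite {}E; set x := s *: _ + _.
exists x; first by have [M M0 HM] := H_curv i; exact: lt_le_trans (HM x).
rewrite (bigD1 i) //= !mxE [X in X - _]addrC [H i i x * _]mulrC addrK.
apply: le_trans (ler_norm_sum _ _ _) _.
apply: (@le_trans _ _ (\sum_(k < n | k != i) (w ord0 k * `|H i k x|) * d)).
  apply: ler_sum => k ki; rewrite normrM !mxE mulrAC ler_wpM2r//; exact: PQ.
by rewrite -mulr_suml ler_wpM2r.
Qed.

(** The off-diagonal terms consume at most the fraction [lambda] of the diagonal one, which leaves
    [(1 - lambda) * M]. *)
Lemma monotone_bound i : exists2 c : R, 0 < c & forall P Q,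
  Q ord0 i <= P ord0 i ->
  (forall k, k != i ->
     `|P ord0 k - Q ord0 k| <= w ord0 k * ((P ord0 i - Q ord0 i) / w ord0 i)) ->
  c * (P ord0 i - Q ord0 i) <= G i P - G i Q.
Proof.
have [M M0 HM] := H_curv i; move: lambda01 => /andP[l0 l1].
exists ((1 - lambda) * M); first by rewrite mulr_gt0// subr_gt0.
move=> P Q QP; rewrite -subr_ge0 in QP.
move=> /(increment_bound (divr_ge0 QP (ltW (w_gt0 i))))[x _].
have := HM x; have := w_gt0 i; move: QP.
move: (H i i x) (P ord0 i - Q ord0 i) (G i P - G i Q) (w ord0 i).
move=> a d g wi d0 wi0 Ma; rewrite ler_norml => /andP[h _].
have E : lambda * wi * a * (d / wi) = lambda * a * d by field; rewrite gt_eqF.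
have : (1 - lambda) * M * d <= (1 - lambda) * a * d.
  by rewrite ler_wpM2r// ler_wpM2l// subr_ge0 ltW.
rewrite E in h; lra.
Qed.

(* The feedback term [q * ...] is absorbed because [lambda * q < 1]: a node
   reacts to its neighbours' reaction to itself without amplification. *)
Lemma sensitivity i P Q (D q : R) : 0 <= D -> 0 <= q <= 1 ->
  (forall k, k != i -> `|P ord0 k - Q ord0 k| <=
     w ord0 k * Num.max D (q * (`|P ord0 i - Q ord0 i| / w ord0 i))) ->
  (G i P - G i Q) * (P ord0 i - Q ord0 i) <= 0 ->
  `|P ord0 i - Q ord0 i| <= w ord0 i * (lambda * D).
Proof.
move=> D0 /andP[q0 q1] PQ Gs; move: lambda01 => /andP[l0 l1].
have wi := w_gt0 i.
have := increment_bound _ PQ; rewrite le_max D0 => /(_ isT)[x Hx].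
move: Gs; move: (P ord0 i - Q ord0 i) (H i i x) Hx (G i P - G i Q).
move=> d a a0 g gd B.
have [->|d0] := eqVneq d 0; first by rewrite normr0 !mulr_ge0// ltW.
have nd : 0 < `|d| by rewrite normr_gt0.
(* As [g] and [d] do not have the same strict sign, [g] cannot offset any of [a * d]. *)
have da : a * `|d| <= `|g - a * d|.
  rewrite -(ler_pM2r nd) -normrM -mulrA -expr2 real_normK ?num_real//.
  rewrite ler_normr; apply/orP; right; lra.
have {da}B := le_trans da B.
have {B}: `|d| <= lambda * w ord0 i * Num.max D (q * (`|d| / w ord0 i)).
  by rewrite -(ler_pM2l a0) (le_trans B)// mulrAC [X in _ <= X]mulrC.
(* If the feedback term is the larger one, the bound reads [|d| <= lambda * q * |d|], impossible for
   nonzero [d]. *)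
have [m|m] := leP (q * (`|d| / w ord0 i)) D.
  by rewrite mulrAC mulrC.
have -> : lambda * w ord0 i * (q * (`|d| / w ord0 i)) = lambda * q * `|d|.
  by field; rewrite gt_eqF.
have lq : lambda * q < 1 by apply: le_lt_trans l1; rewrite ler_piMr// ltW.
by rewrite leNgt gtr_pMl// lq.
Qed.

(** Covers two cases: the other coordinates are constant (Jacobi step), or they respond to [y] as
    prescribed by messages. *)
Lemma curve_monotone i (P : R -> 'rV[R]_n) :
  (forall y, P y ord0 i = y) ->
  (forall k, k != i -> forall y y',
     `|P y ord0 k - P y' ord0 k| <= w ord0 k * (`|y - y'| / w ord0 i)) ->
  continuous (fun y => G i (P y)) /\
  exists2 c : R, 0 < c & forall y y', y' <= y ->
    c * (y - y') <= G i (P y) - G i (P y').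
Proof.
move=> Pi Pk; split.
  apply: G_cont => k; have [->|ki] := eqVneq k i.
    have -> : (fun y => P y ord0 i) = id by exact: funext.
    by move=> y; exact: cvg_id.
  move=> y; apply/cvgrPdist_lt => eps e0.
  have r0 : 0 < eps * (w ord0 i / w ord0 k) by rewrite mulr_gt0// divr_gt0.
  apply/nbhs_ballP; exists (eps * (w ord0 i / w ord0 k)) => // z.
  rewrite /ball /= => yz; apply: le_lt_trans (Pk _ ki _ _) _.
  by rewrite mulrC -ltr_pdivlMr// ltr_pdivrMr// -mulrA [X in _ < _ * X]mulrC.
have [c c0 Hc] := monotone_bound i; exists c => // y y' yy'.
have := Hc (P y) (P y'); rewrite !Pi; apply => // k ki.
by have := Pk k ki y y'; rewrite (@ger0_norm _ (y - y')) ?subr_ge0.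
Qed.

Definition with_coord i (x : 'rV[R]_n) (y : R) : 'rV[R]_n :=
  \row_k (if k == i then y else x ord0 k).

Lemma with_coord_id i x y : with_coord i x y ord0 i = y.
Proof. by rewrite mxE eqxx. Qed.

Lemma with_coord_neq i x y k : k != i -> with_coord i x y ord0 k = x ord0 k.
Proof. by rewrite mxE => /negPf ->. Qed.

Lemma coordinate_zero i x : exists y, G i (with_coord i x y) = 0.
Proof.
have [|k ki y y'|cG [c c0 mono]] := curve_monotone (i := i) (P := with_coord i x).
- exact: with_coord_id.
- rewrite !with_coord_neq// subrr normr0.
  by apply: mulr_ge0; [exact: ltW|apply: divr_ge0 => //; exact: ltW].
- exact: strongly_monotone_zero c0 cG mono.
Qed.

(* Jacobi iteration, a contraction in the max norm weighted by w. *)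
Lemma critical_point_exists : exists x, forall i, G i x = 0.
Proof.
have /choice[Z HZ] : forall p : 'I_n * 'rV[R]_n,
  exists y, G p.1 (with_coord p.1 p.2 y) = 0 by move=> p; exact: coordinate_zero.
have {}HZ i x : G i (with_coord i x (Z (i, x))) = 0 := HZ (i, x).
(* [W] turns the weighted max norm into the plain one; [f] is the Jacobi step in the scaled
   coordinates. *)
pose W (z : 'rV[R]_n) : 'rV[R]_n := \row_k (w ord0 k * z ord0 k).
pose f (z : 'rV[R]_n) : 'rV[R]_n := \row_i (Z (i, W z) / w ord0 i).
have [l0 l1] := andP lambda01.
have Cf : is_contraction (totalfun f).
  exists (NngNum (ltW l0)); split => //= -[z z'] _ /=.
  apply: rV_norm_le => [|i]; first by rewrite mulr_ge0// ltW.
  rewrite !mxE -mulrBl normrM [X in _ * X]gtr0_norm ?invr_gt0//.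
  rewrite ler_pdivrMr// mulrC.
  (* The other coordinates do not react to coordinate [i]: no feedback, hence [q = 0]. *)
  have := @sensitivity i (with_coord i (W z) (Z (i, W z)))
    (with_coord i (W z') (Z (i, W z'))) `|z - z'| 0.
  rewrite !with_coord_id !HZ (subrr 0) (mul0r (_ - _)).
  apply => //; first by rewrite lexx ler01.
  move=> k ki; rewrite !with_coord_neq// mul0r !mxE -mulrBr normrM.
  rewrite gtr0_norm// ler_pM2l// le_max.
  by have := rV_norm_ge (z - z') k; rewrite !mxE => ->.
have [z _ zE] := banach_fixed_point Cf closedT (ex_intro _ 0 I).
exists (W z) => i; rewrite -[RHS](HZ i (W z)); congr G.
apply/rowP => k; rewrite !mxE; case: eqVneq => // ->.
by rewrite {1}zE mxE mulrC divfK ?gt_eqF.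
Qed.

End DominantSystem.

(** * Convexity *)

(** If [F y < F x], convexity keeps the difference quotients from [x] towards [y] below the negative
    number [F y - F x], against a zero derivative. *)
Lemma strictly_convex_stationary_minimizer (R : realType) (V : normedModType R)
    (F : V -> R) (x : V) :
  (forall (y z : V) (s : R), y != z -> 0 < s < 1 ->
     F (s *: y + (1 - s) *: z) < s * F y + (1 - s) * F z) ->
  (forall v, is_derive x v F 0) -> unique_minimizer F x.
Proof.
move=> cF dF.
have minF y : F x <= F y.
  have [->|yx] := eqVneq y x; first exact: lexx.
  rewrite leNgt; apply/negP => lt; rewrite -subr_gt0 in lt.
  have [r r0 Hr] := is_derive_lim (dF (y - x)) lt.
  pose h := Num.min r 1 / 2.
  have m0 : 0 < Num.min r 1 by rewrite lt_min r0 ltr01.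
  have mr : Num.min r 1 <= r by rewrite ge_min lexx.
  have m1 : Num.min r 1 <= 1 by rewrite ge_min lexx orbT.
  have h0 : 0 < h by rewrite /h; lra.
  have hr : h < r by rewrite /h; lra.
  have h1 : h < 1 by rewrite /h; lra.
  clearbody h.
  have := Hr h; rewrite gt_eqF// gtr0_norm// subr0 => /(_ isT hr).
  have -> : h *: (y - x) + x = h *: y + (1 - h) *: x.
    by rewrite scalerBr scalerBl scale1r addrA addrAC.
  have h01 : 0 < h < 1 by rewrite h0 h1.
  have C := cF _ _ _ yx h01.
  rewrite ltr_norml => /andP[+ _]; rewrite ltr_pdivlMl//.
  move: C; move: (F _) => z; lra.
move=> y yx.
(* Strictness comes from comparing [F x] with the value at the midpoint of [x] and [y]. *)
have h01 : 0 < (2^-1 : R) < 1 by apply/andP; split; lra.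
have := le_lt_trans (minF _) (cF _ _ _ yx h01); lra.
Qed.

Section Objective.
Variables (R : realType) (n : nat) (e : rel 'I_n).
Variables (f1 : 'I_n -> R -> R) (f2 : 'I_n -> 'I_n -> R * R -> R).
Hypothesis e_simple : simple_graph e.
Hypothesis f12 : pairwise_separable_convex e f1 f2.

Lemma convex_plane (f : R * R -> R) (p q : R * R) (s : R) :
  convex_function [set: R * R] f -> 0 < s < 1 ->
  f (s *: p + (1 - s) *: q) <= s * f p + (1 - s) * f q.
Proof.
move=> cf /andP[s0 s1].
have := cf (Itv01 (ltW s0) (ltW s1)) p q (in_setT _) (in_setT _).
by [].
Qed.

(** The edge factors are merely convex; strictness comes from the vertex term at a coordinate where
    [x] and [y] differ. *)
Lemma objective_strictly_convex (x y : 'rV[R]_n) (s : R) : x != y -> 0 < s < 1 ->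
  objective e f1 f2 (s *: x + (1 - s) *: y) <
  s * objective e f1 f2 x + (1 - s) * objective e f1 f2 y.
Proof.
move=> xy s01; rewrite /objective !mulrDr addrACA.
apply: ltr_leD; last first.
  rewrite !mulr_sumr -big_split /=; apply: ler_sum => i _.
  rewrite !mulr_sumr -big_split /=; apply: ler_sum => j /andP[_ eij].
  rewrite !mxE; exact: (convex_plane (_, _) (_, _) (psc_edge f12 eij).1 s01).
rewrite !mulr_sumr -big_split /=.
have le i : f1 i ((s *: x + (1 - s) *: y) ord0 i) <=
    s * f1 i (x ord0 i) + (1 - s) * f1 i (y ord0 i).
  rewrite !mxE; have [->|ne] := eqVneq (x ord0 i) (y ord0 i).
    by rewrite -!mulrDl subrKC !mul1r.
  by have [sc _ _] := psc_vertex f12 i; apply/ltW/sc.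
have [i xyi] : exists i, x ord0 i != y ord0 i.
  apply/existsP; rewrite -negb_forall; apply: contra_neqN xy => /forallP H.
  by apply/rowP => i; exact/eqP.
rewrite (bigD1 i) //= [ltRHS](bigD1 i) //=; apply: ltr_leD; last first.
  by apply: ler_sum => k _; exact: le.
by rewrite !mxE; have [sc _ _] := psc_vertex f12 i; exact: sc.
Qed.

Lemma critical_point_minimizer (x : 'rV[R]_n) :
  (forall i, gradient e f1 f2 i x = 0) ->
  unique_minimizer (objective e f1 f2) x.
Proof.
move=> x0; apply: strictly_convex_stationary_minimizer.
  exact: objective_strictly_convex.
move=> v; have := is_derive_objective e_simple f12 x v.
by rewrite big1 // => i _; rewrite x0 mulr0.
Qed.

End Objective.

(** * Messages *)

Section MinSum.
Variables (R : realType) (n : nat) (e : rel 'I_n).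
Variables (f1 : 'I_n -> R -> R) (f2 : 'I_n -> 'I_n -> R * R -> R).
Variables (lambda : R) (w : 'rV[R]_n).
Hypothesis e_simple : simple_graph e.
Hypothesis f12 : pairwise_separable_convex e f1 f2.
Hypothesis F_dom : scaled_diagonally_dominant lambda w (objective e f1 f2).

Let e_sym : symmetric e := e_simple.1.
Let e_irr : irreflexive e := e_simple.2.
Let lambda01 : 0 < lambda < 1. Proof. by have [] := F_dom. Qed.
Let w_gt0 i : 0 < w ord0 i. Proof. by have [_ /(_ i)] := F_dom. Qed.
Let G := gradient e f1 f2.

Let G_sensitivity := sensitivity lambda01 w_gt0
  (is_derive_gradient e_simple f12) (hessian_curvature e_simple f12)
  (fun i x => hessian_dominant e_simple f12 i x F_dom).

Let G_curve := curve_monotone lambda01 w_gt0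
  (is_derive_gradient e_simple f12) (gradient_continuous e_simple f12)
  (hessian_curvature e_simple f12)
  (fun i x => hessian_dominant e_simple f12 i x F_dom).

(* The derivative of the message K from u to i is that of the factor f2 u i
   frozen at x_u = g y, up to a monotone term m that is nonzero only for
   initial messages. *)
Definition message (u i : 'I_n) (K g m : R -> R) : Prop :=
  [/\ forall y : R, is_derive y 1 K ('D_(dir2 R) (f2 u i) (g y, y) + m y),
      forall y y', `|g y - g y'| <= w ord0 u * (lambda * (`|y - y'| / w ord0 i)),
      continuous m & {homo m : y y' / y <= y'}].

(* Coordinates other than i and its neighbours do not enter the i-th partial
   derivative of F; 0 is an arbitrary value for them. *)
Definition response (i : 'I_n) (g : 'I_n -> R -> R) (y : R) : 'rV[R]_n :=
  \row_k (if k == i then y else if e i k then g k y else 0).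

Lemma response_id i g y : response i g y ord0 i = y.
Proof. by rewrite mxE eqxx. Qed.

Lemma response_edge i g y k : e i k -> response i g y ord0 k = g k y.
Proof.
by move=> eik; rewrite mxE eik; case: eqP => // ki; rewrite ki e_irr in eik.
Qed.

Lemma response_far i g y k : k != i -> ~~ e i k -> response i g y ord0 k = 0.
Proof. by rewrite mxE => /negPf -> /negPf ->. Qed.

(** * The function minimized at one node *)

Section Node.
Variables (i : 'I_n) (K g m : 'I_n -> R -> R).
Hypothesis K_msg : forall u, e i u -> message u i (K u) (g u) (m u).

(** The derivative of the node function, written so that stationarity becomes an equation for the
    gradient of F at a point of R^V. *)
Definition slope y := G i (response i g y) + \sum_(u < n | e i u) m u y.

Lemma is_derive_node (y : R) :
  is_derive y 1 (fun y => f1 i y + \sum_(u < n | e i u) K u y) (slope y).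
Proof.
have [_ _ [D _ _]] := psc_vertex f12 i.
have H1 : is_derive y 1 (f1 i) (derive1 (f1 i) y).
  by rewrite derive1E; exact: derivableP.
have H2 : is_derive y 1 (fun y => \sum_(u < n | e i u) K u y)
   (\sum_(u < n | e i u) ('D_(dir2 R) (f2 u i) (g u y, y) + m u y)).
  by apply: is_derive_bigsum => u /K_msg[].
have := is_deriveD H1 H2; congr is_derive.
rewrite /slope /G /gradient response_id big_split /= -addrA; congr (_ + (_ + _)).
by apply: eq_bigr => u eiu; rewrite response_edge.
Qed.

Lemma slope_noise_mono y y' : y' <= y ->
  \sum_(u < n | e i u) m u y' <= \sum_(u < n | e i u) m u y.
Proof. by move=> yy; apply: ler_sum => u /K_msg[_ _ _ ->]. Qed.

(** The responses have Lipschitz ratio [lambda * w_u / w_i], within what [curve_monotone] allows,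
    and the monotone terms [m] can only help. *)
Lemma slope_strongly_monotone : continuous slope /\
  exists2 c : R, 0 < c & forall y y', y' <= y -> c * (y - y') <= slope y - slope y'.
Proof.
have [l0 l1] := andP lambda01.
have [|k ki y y'|cG [c c0 mono]] := G_curve (i := i) (P := response i g).
- exact: response_id.
- have D0 : 0 <= `|y - y'| / w ord0 i by rewrite divr_ge0// ltW.
  have [eik|eik] := boolP (e i k); last first.
    by rewrite !response_far// subrr normr0 mulr_ge0// ltW.
  rewrite !response_edge//; have [_ H _ _] := K_msg eik.
  by apply: le_trans (H _ _) _; rewrite ler_pM2l// ler_piMl// ltW.
split.
  move=> y; apply: cvgD; first exact: cG.
  apply: cvg_big => [|u /K_msg[_ _ cm _]]; [exact: add_continuous|exact: cm].
exists c => // y y' yy'; apply: le_trans (mono _ _ yy') _.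
have := slope_noise_mono yy'; rewrite /slope /G.
by move: (\sum_(_ < _ | _) _) (\sum_(_ < _ | _) _) => a b; lra.
Qed.

Lemma node_minimizer_exists : exists y, slope y = 0 /\
  unique_minimizer (fun y => f1 i y + \sum_(u < n | e i u) K u y) y.
Proof.
have [c [k k0 mono]] := slope_strongly_monotone.
have [y sy] := strongly_monotone_zero k0 c mono.
exists y; split=> //; refine (strongly_monotone_minimizer k0 mono is_derive_node sy).
Qed.

End Node.

Lemma scaled_lipschitz_continuous (g : R -> R) (a b : R) :
  0 < a -> 0 < b ->
  (forall y y', `|g y - g y'| <= a * (lambda * (`|y - y'| / b))) -> continuous g.
Proof.
move=> a0 b0 Lip y; have [l0 _] := andP lambda01.
apply/cvgrPdist_lt => eps e0.
have r0 : 0 < eps / (a * lambda / b) by rewrite !divr_gt0// mulr_gt0.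
apply/nbhs_ballP; exists (eps / (a * lambda / b)) => // z.
rewrite /ball /= ltr_pdivlMr ?divr_gt0 ?mulr_gt0// => yz.
apply: le_lt_trans (Lip _ _) _; rewrite (_ : a * _ = `|y - z| * (a * lambda / b)) //.
ring.
Qed.

Lemma unique_minimizer_eq (b : R -> R) y y' :
  unique_minimizer b y -> unique_minimizer b y' -> y = y'.
Proof.
move=> Hy Hy'; apply/eqP; apply: contraT => ne.
have := lt_trans (Hy' _ ne); rewrite eq_sym in ne => /(_ _ (Hy _ ne)).
by rewrite ltxx.
Qed.

(* Fixing x_j = x in the factor f2 i j amounts to a message from j to i that
   reports the constant x. *)
Definition freeze (j : 'I_n) (a : R -> R) (K : 'I_n -> R -> R) (u : 'I_n) : R -> R :=
  if u == j then a else K u.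

Lemma local_objectiveE i j (Jin : 'I_n -> R -> R) x y : e i j ->
  local_objective e f1 f2 Jin i j x y =
  f1 i y + \sum_(u < n | e i u) freeze j (fun y => f2 j i (x, y)) Jin u y.
Proof.
move=> eij; rewrite /local_objective -addrA; congr (_ + _).
rewrite [RHS](bigD1 j) //= /freeze eqxx (psc_factor_sym f12) //; congr (_ + _).
by apply: eq_bigr => u /andP[_ /negPf ->].
Qed.

Lemma frozen_message j i x : e i j ->
  message j i (fun y => f2 j i (x, y)) (cst x) (cst 0).
Proof.
move=> eij; have [_ [D2 _]] := edge_C1 e_simple f12 eij; split => //.
- by move=> y; rewrite addr0; exact: is_derive_snd.
- move=> y y'; rewrite subrr normr0; have [l0 _] := andP lambda01.
  by apply: mulr_ge0; [exact: ltW|apply: mulr_ge0; [exact: ltW|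
     apply: divr_ge0 => //; exact: ltW]].
- by move=> y; exact: cvg_cst.
Qed.

Lemma freeze_messages i j (K g m : 'I_n -> R -> R) x : e i j ->
  (forall u, e i u -> message u i (K u) (g u) (m u)) ->
  forall u, e i u -> message u i (freeze j (fun y => f2 j i (x, y)) K u)
    (freeze j (cst x) g u) (freeze j (cst 0) m u).
Proof.
move=> eij H u eiu; rewrite /freeze; case: eqP => [->|_]; last exact: H.
exact: frozen_message.
Qed.

Lemma inf_minimum (b : R -> R) y : (forall z, b y <= b z) -> inf (range b) = b y.
Proof.
move=> H; apply/eqP; rewrite eq_le; apply/andP; split.
  by apply: ge_inf; [exists (b y) => _ [z _ <-]|exists y].
by apply: lb_le_inf; [exists (b y), y|move=> _ [z _ <-]].
Qed.

(** [g'] selects the minimizer. Its Lipschitz bound comes from [sensitivity], and the envelope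
    theorem gives the derivative of [Jout] with no extra term: a single update removes [m]. *)
Lemma updated_message i j (Jin g m : 'I_n -> R -> R) (kappa : R) (Jout : R -> R) :
  e i j -> (forall u, e i u -> message u i (Jin u) (g u) (m u)) ->
  (forall x, Jout x = inf (range (local_objective e f1 f2 Jin i j x)) + kappa) ->
  exists g', (forall x, slope i (freeze j (cst x) g) (freeze j (cst 0) m) (g' x) = 0)
    /\ message i j Jout g' (cst 0).
Proof.
move=> eij Hin Hout; have [l0 l1] := andP lambda01.
have /choice[g' Hg'] x := node_minimizer_exists (freeze_messages x eij Hin).
have g'0 x := (Hg' x).1; have g'min x := (Hg' x).2.
exists g'; split => //.
have Lip x x' : `|g' x - g' x'| <= w ord0 i * (lambda * (`|x - x'| / w ord0 j)).
  have := @G_sensitivity i (response i (freeze j (cst x) g) (g' x))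
     (response i (freeze j (cst x') g) (g' x')) (`|x - x'| / w ord0 j) lambda.
  rewrite !response_id; apply.
  - by rewrite divr_ge0// ltW.
  - by rewrite !ltW.
  - move=> k ki; set B := Num.max _ _.
    have B1 : `|x - x'| / w ord0 j <= B by rewrite le_max lexx.
    have B2 : lambda * (`|g' x - g' x'| / w ord0 i) <= B by rewrite le_max lexx orbT.
    have B0 : 0 <= B by apply: le_trans B1; rewrite divr_ge0// ltW.
    have [eik|eik] := boolP (e i k); last first.
      by rewrite !response_far// subrr normr0 mulr_ge0// ltW.
    rewrite !response_edge// /freeze; case: eqP => [->|_] /=.
      by rewrite mulrC -ler_pdivrMr.
    have [_ H _ _] := Hin _ eik.
    by apply: le_trans (H _ _) _; rewrite ler_pM2l.
  (* Both slopes vanish, so the gradient difference is minus the difference of the monotone terms,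
     which gives the required sign. *)
  - have M y y' := @slope_noise_mono i _ _ _ (freeze_messages x eij Hin) y y'.
    have := g'0 x'; have := g'0 x; rewrite /slope /G.
    move: (M (g' x) (g' x')) (M (g' x') (g' x)).
    move: (\sum_(u < n | e i u) _) (\sum_(u < n | e i u) _).
    move: (gradient _ _ _ i _) (gradient _ _ _ i _).
    move=> a' a S S' M1 M2 aS aS'.
    have -> : a - a' = S' - S by lra.
    have [xx|/ltW xx] := leP (g' x) (g' x').
      by rewrite mulr_ge0_le0 ?subr_ge0 ?subr_le0 ?M2.
    by rewrite mulr_le0_ge0 ?subr_ge0 ?subr_le0 ?M1.
have cg' : continuous g'.
  exact: scaled_lipschitz_continuous (w_gt0 i) (w_gt0 j) Lip.
have [_ [D2 [_ C2]]] : C1_plane (f2 i j) by apply: (edge_C1 e_simple f12); rewrite e_sym.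
split=> //; first last.
- by move=> y; exact: cvg_cst.
move=> x; rewrite addr0; apply: is_derive_envelope => // {}x x'.
have E z : Jout z = local_objective e f1 f2 Jin i j z (g' z) + kappa.
  rewrite Hout; congr (_ + _); apply: inf_minimum => y.
  have [->|ne] := eqVneq y (g' z); first exact: lexx.
  by rewrite !local_objectiveE//; apply/ltW/(g'min z).
rewrite (E x) Hout.
(* The choice [g' x], optimal at [x], is a competitor at [x']; all terms but the factor [f2 i j]
   cancel. *)
have : inf (range (local_objective e f1 f2 Jin i j x')) <=
       local_objective e f1 f2 Jin i j x' (g' x).
  apply: ge_inf; last by exists (g' x).
  exists (local_objective e f1 f2 Jin i j x' (g' x')) => _ [y _ <-].
  have [->|ne] := eqVneq y (g' x'); first exact: lexx.
  by rewrite !local_objectiveE//; apply/ltW/(g'min x').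
rewrite /local_objective; move: (inf _) (\sum_(_ < _ | _) _) => I S; lra.
Qed.

(** The initialization assumption says that the difference between the derivative of [K] and that of
    the factor frozen at [z] is nondecreasing. *)
Lemma initial_message i j (K : R -> R) (z : R) : e i j -> C2_real K ->
  (forall x, 'D_(dir2 R) ('D_(dir2 R) (f2 i j)) (z, x) <= derive1 (derive1 K) x) ->
  message i j K (cst z) (fun y => derive1 K y - 'D_(dir2 R) (f2 i j) (z, y)).
Proof.
move=> eij [D DD _] Kz; have eji : e j i by rewrite e_sym.
have [_ [D2 _]] := edge_C1_derive e_simple f12 eji.
have Dm (y : R) : is_derive y 1 (fun y => derive1 K y - 'D_(dir2 R) (f2 i j) (z, y))
    (derive1 (derive1 K) y - 'D_(dir2 R) ('D_(dir2 R) (f2 i j)) (z, y)).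
  apply: is_deriveB; last exact: is_derive_snd.
  by rewrite derive1E; exact: derivableP.
have [l0 _] := andP lambda01.
split.
- by move=> y; rewrite addrC subrK derive1E; exact: derivableP.
- move=> y y'; rewrite subrr normr0.
  by apply: mulr_ge0; [exact: ltW|apply: mulr_ge0; [exact: ltW|
     apply: divr_ge0 => //; exact: ltW]].
- exact: is_derive1_continuous Dm.
- move=> y y' yy'; have [s _ E] := MVT_step y (y' - y) Dm.
  rewrite -subr_ge0; move: E; rewrite [y + (y' - y)]addrC subrK => ->.
  by rewrite mulr_ge0 ?subr_ge0.
Qed.

(** * Contraction of the messages towards a critical point *)

Section Contraction.
Variable xs : 'rV[R]_n.
Hypothesis xs_crit : forall i, G i xs = 0.
Variable q : R.
Hypothesis lambda_lt_q : lambda < q.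
Hypothesis q_lt1 : q < 1.

Let l0 : 0 < lambda. Proof. by case/andP: lambda01. Qed.
Let q0 : 0 < q. Proof. exact: lt_trans lambda_lt_q. Qed.

(** With the extra term zero, stationarity of a node is a zero of the gradient component and can be
    compared with [xs]. *)
Definition near_opt (eps : R) (u i : 'I_n) (K : R -> R) : Prop :=
  exists2 g, message u i K g (cst 0) & forall y,
    `|g y - xs ord0 u| <=
      w ord0 u * Num.max eps (q * (`|y - xs ord0 i| / w ord0 i)).

Lemma near_optW eps eps' u i K : eps <= eps' ->
  near_opt eps u i K -> near_opt eps' u i K.
Proof.
move=> ee [g mg H]; exists g => // y; apply: le_trans (H y) _.
by rewrite ler_pM2l// ge_max !le_max ee lexx orbT.
Qed.

(* Since q > lambda, the Lipschitz bound of slope lambda plus a constant is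
   dominated by the maximum of a larger constant and a line of slope q. *)
Lemma near_opt_exists u i K g : message u i K g (cst 0) ->
  exists2 eps, 0 <= eps & near_opt eps u i K.
Proof.
move=> mg; have [_ Lip _ _] := mg.
pose c := `|g (xs ord0 i) - xs ord0 u| / w ord0 u.
have c0 : 0 <= c by rewrite divr_ge0// ltW.
have ql : 0 < q - lambda by rewrite subr_gt0.
(* The lines [lambda * d + c] and [q * d] meet at [d = c / (q - lambda)]; this is their common value
   there. *)
exists (c * (q / (q - lambda))); first by rewrite mulr_ge0// divr_ge0 // ltW.
exists g => // y; rewrite -(subrK (g (xs ord0 i)) (g y)) -addrA.
apply: le_trans (ler_normD _ _) _.
apply: le_trans (lerD (Lip y (xs ord0 i)) (lexx _)) _.
have -> : `|g (xs ord0 i) - xs ord0 u| = w ord0 u * c by rewrite mulrC divfK ?gt_eqF.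
rewrite -mulrDr ler_pM2l//; move: (`|y - _| / _) => d.
have [dc|dc] := leP d (c / (q - lambda)).
  rewrite le_max; apply/orP; left.
  have : lambda * d <= lambda * (c / (q - lambda)) by rewrite ler_pM2l.
  have -> : c * (q / (q - lambda)) = lambda * (c / (q - lambda)) + c.
    by field; rewrite gt_eqF.
  lra.
rewrite le_max; apply/orP; right; move: dc; rewrite ltr_pdivrMr//; lra.
Qed.

Lemma near_opt_family eps i (K : 'I_n -> R -> R) :
  (forall u, e i u -> near_opt eps u i (K u)) ->
  exists g : 'I_n -> R -> R, forall u, e i u ->
    message u i (K u) (g u) (cst 0) /\ forall y, `|g u y - xs ord0 u| <=
      w ord0 u * Num.max eps (q * (`|y - xs ord0 i| / w ord0 i)).
Proof.
move=> H; have /choice[g Hg] : forall u, exists g, e i u ->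
    message u i (K u) g (cst 0) /\ forall y, `|g y - xs ord0 u| <=
      w ord0 u * Num.max eps (q * (`|y - xs ord0 i| / w ord0 i)).
  move=> u; case: (boolP (e i u)) => [/H[g mg Hg]|_]; last by exists (cst 0).
  by exists g.
by exists g.
Qed.

Lemma near_opt_response (D : R) i g (y : R) : 0 <= D -> G i (response i g y) = 0 ->
  (forall u, e i u -> `|g u y - xs ord0 u| <=
     w ord0 u * Num.max D (q * (`|y - xs ord0 i| / w ord0 i))) ->
  `|y - xs ord0 i| <= w ord0 i * (lambda * D).
Proof.
move=> D0 Gy Hg.
(* Zero away from [i] and its neighbours, like [response], so that the two points agree there; the
   [i]-th gradient component is that of [xs]. *)
pose Q := \row_k (if (k == i) || e i k then xs ord0 k else 0) : 'rV[R]_n.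
have Qi : Q ord0 i = xs ord0 i by rewrite mxE eqxx.
have GQ : G i Q = 0.
  rewrite -(xs_crit i) /G /gradient Qi; congr (_ + _).
  by apply: eq_bigr => u eiu; rewrite mxE eiu orbT.
have := @G_sensitivity i (response i g y) Q D q; rewrite response_id Qi; apply=> //.
- by rewrite !ltW.
- move=> k ki; have [eik|eik] := boolP (e i k).
    by rewrite response_edge// mxE eik orbT; exact: Hg.
  rewrite response_far// mxE (negPf ki) (negPf eik) subrr normr0.
  by rewrite mulr_ge0 ?le_max ?D0// ltW.
- have -> : gradient e f1 f2 i Q = 0 by [].
  have -> : gradient e f1 f2 i (response i g y) = 0 by [].
  by rewrite subr0 mul0r.
Qed.

Lemma near_opt_update eps i j (Jin : 'I_n -> R -> R) (kappa : R) (Jout : R -> R) :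
  0 <= eps -> e i j -> (forall u, e i u -> near_opt eps u i (Jin u)) ->
  (forall x, Jout x = inf (range (local_objective e f1 f2 Jin i j x)) + kappa) ->
  near_opt (q * eps) i j Jout.
Proof.
move=> eps0 eij /near_opt_family[g Hg] Hout.
have Hm u : e i u -> message u i (Jin u) (g u) (cst 0) by move=> /Hg[].
have [g' [g'0 mg']] := updated_message (m := fun=> cst 0) eij Hm Hout.
exists g' => // x; set B := `|x - _| / _.
have B0 : 0 <= B by rewrite divr_ge0// ltW.
have D0 : 0 <= Num.max eps B by rewrite le_max eps0.
have R1 : G i (response i (freeze j (cst x) g) (g' x)) = 0.
  have := g'0 x; rewrite /slope big1 ?addr0// => u _.
  by rewrite /freeze; case: eqP.
have R2 u : e i u -> `|freeze j (cst x) g u (g' x) - xs ord0 u| <= w ord0 u *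
    Num.max (Num.max eps B) (q * (`|g' x - xs ord0 i| / w ord0 i)).
  move=> eiu; rewrite /freeze; case: eqP => [->|_] /=.
    by rewrite mulrC -ler_pdivrMr// !le_max lexx orbT.
  apply: le_trans ((Hg _ eiu).2 _) _; rewrite ler_pM2l// ge_max !le_max.
  by rewrite !lexx !orbT.
apply: le_trans (near_opt_response D0 R1 R2) _.
by rewrite ler_pM2l// -maxr_pMr ?ler_wpM2r// ltW.
Qed.

(** In a belief no neighbour is frozen, so [near_opt_response] applies with [D = eps]. *)
Lemma near_opt_belief (eps : R) i (K : 'I_n -> 'I_n -> R -> R) (y : R) : 0 <= eps ->
  (forall u, e i u -> near_opt eps u i (K u i)) ->
  unique_minimizer (belief e f1 K i) y ->
  `|y - xs ord0 i| <= w ord0 i * (lambda * eps).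
Proof.
move=> eps0 /near_opt_family[g Hg] ymin.
have Hm u : e i u -> message u i (K u i) (g u) (cst 0) by move=> /Hg[].
have [z [sz zmin]] := node_minimizer_exists (m := fun=> cst 0) Hm.
have <- : z = y by apply: unique_minimizer_eq zmin ymin.
apply: (near_opt_response (g := g) eps0).
  by move: sz; rewrite /slope big1 ?addr0.
by move=> u /Hg[].
Qed.

End Contraction.

End MinSum.

(** * Asynchronous convergence *)

Lemma infinite_nat_unbounded (A : set nat) (N : nat) :
  infinite_set A -> exists2 t, (N <= t)%N & A t.
Proof.
move=> infA; apply: contrapT => H; apply: infA.
apply: (@sub_finite_set _ _ `I_N) => [t At|]; last exact: finite_II.
by rewrite /= ltnNge; apply/negP => Nt; apply: H; exists t.
Qed.

Lemma uniform_bound (R : realType) (I : finType) (Q : I -> R -> Prop) :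
  (forall i r r', r <= r' -> Q i r -> Q i r') ->
  (forall i, exists2 r, 0 <= r & Q i r) -> exists2 r, 0 <= r & forall i, Q i r.
Proof.
move=> mono H.
have /choice[r Hr] i : exists r, 0 <= r /\ Q i r.
  by have [r] := H i; exists r.
exists (\sum_i r i) => [|i]; first by apply: sumr_ge0 => i _; have [] := Hr i.
apply: mono (Hr i).2; rewrite (bigD1 i) //= lerDl.
by apply: sumr_ge0 => k _; have [] := Hr k.
Qed.

Lemma uniform_time (I : finType) (Q : I -> nat -> Prop) :
  (forall i, exists N, forall t, (N <= t)%N -> Q i t) ->
  exists N, forall t, (N <= t)%N -> forall i, Q i t.
Proof.
move=> /choice[N HN]; exists (\max_i N i)%N => t Nt i; apply: HN.
by apply: leq_trans Nt; exact: leq_bigmax.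
Qed.

Section Asynchronism.
Variables (n : nat) (e : rel 'I_n).
Variables (T : 'I_n -> set nat) (tau : 'I_n -> 'I_n -> nat -> nat).
Hypothesis e_sym : symmetric e.
Hypothesis T_total : totally_asynchronous e T tau.

(** Turns the sequential assumption into a uniform threshold: otherwise there are update times
    [s k >= k] whose delays stay below [N]. *)
Lemma delays_unbounded N : exists N', forall t, (N' <= t)%N ->
  forall i j, e i j -> T i t -> (N <= tau j i t)%N.
Proof.
suff [N' H] : exists N', forall t, (N' <= t)%N -> forall ij : 'I_n * 'I_n,
    e ij.1 ij.2 -> T ij.1 t -> (N <= tau ij.2 ij.1 t)%N.
  by exists N' => t Nt i j; exact: H t Nt (i, j).
apply: uniform_time => -[i j] /=; apply: contrapT => H.
have /choice[s Hs] : forall k, exists t,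
    [/\ (k <= t)%N, e i j, T i t & (tau j i t < N)%N].
  move=> k; apply: contrapT => Hk; apply: H; exists k => t kt eij Tt.
  by rewrite leqNgt; apply/negP => lt; apply: Hk; exists t.
have s_cvg : s k @[k --> \oo] --> \oo.
  apply/cvgnyPge => A; exists A => // k /= Ak.
  by apply: leq_trans Ak _; have [] := Hs k.
have [_ eij _ _] := Hs 0%N.
have Ts k : T i (s k) by have [] := Hs k.
have /cvgnyPge/(_ N)[M _ HM] := (T_total i).2 s Ts s_cvg j eij.
have := HM M (leqnn M); rewrite /= leqNgt; have [_ _ _ ->] := Hs M.
by [].
Qed.

(** One asynchronous round: once the delays reach past [N], each vertex need only update once more,
    and [B] persists until its next update. *)
Lemma eventually_updated (A B : nat -> 'I_n -> 'I_n -> Prop) :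
  (forall t i j, e i j -> T i t -> (forall u, e i u -> A (tau u i t) u i) ->
     B t.+1 i j) ->
  (forall t i j, e i j -> ~ T i t -> B t i j -> B t.+1 i j) ->
  (exists N, forall t, (N <= t)%N -> forall i j, e i j -> A t i j) ->
  exists N, forall t, (N <= t)%N -> forall i j, e i j -> B t i j.
Proof.
move=> upd keep [N HA]; have [N' HN'] := delays_unbounded N.
suff [M HM] : exists M, forall t, (M <= t)%N -> forall i j, e i j -> B t i j.
  by exists M.
apply: uniform_time => i.
have [s Ns Ts] := infinite_nat_unbounded N' (T_total i).1.
(* Messages computed at time [s] are in force from [s + 1]. *)
exists s.+1; elim=> // t IH; rewrite ltnS => st j eij.
have [Tt|Tt] := pselect (T i t).
  apply: upd => // u eiu; apply: HA; last by rewrite e_sym.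
  exact: HN' (leq_trans Ns st) _ _ eiu Tt.
(* The case [t = s] is excluded, since [i] updates at [s]. *)
apply: keep => //; apply: IH => //; rewrite ltn_neqAle st andbT.
by apply/eqP => E; apply: Tt; rewrite -E.
Qed.

End Asynchronism.

Section Convergence.
Variables (R : realType) (n : nat) (e : rel 'I_n).
Variables (f1 : 'I_n -> R -> R) (f2 : 'I_n -> 'I_n -> R * R -> R).
Variables (lambda : R) (w : 'rV[R]_n).
Variables (T : 'I_n -> set nat) (tau : 'I_n -> 'I_n -> nat -> nat).
Variables (kappa : nat -> 'I_n -> 'I_n -> R) (J : nat -> 'I_n -> 'I_n -> R -> R).
Hypothesis e_simple : simple_graph e.
Hypothesis f12 : pairwise_separable_convex e f1 f2.
Hypothesis F_dom : scaled_diagonally_dominant lambda w (objective e f1 f2).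
Hypothesis J_init : initialization e f2 (J 0%N).
Hypothesis tau_causal : delays_causal e tau.
Hypothesis J_alg : async_min_sum e f1 f2 T tau kappa J.
Hypothesis T_total : totally_asynchronous e T tau.

Let e_sym : symmetric e := e_simple.1.

Local Notation msg := (message f2 lambda w).

(** Strong induction on time, as delays may reach arbitrarily far back. *)
Lemma messages_regular t i j : e i j -> exists g m, msg i j (J t i j) g m.
Proof.
elim/ltn_ind: t i j => -[_|t IH] i j eij.
  have [C2 [z Hz]] := J_init eij.
  by exists (cst z); eexists; exact: (initial_message e_simple f12 F_dom eij C2 Hz).
have [upd keep] := J_alg t eij.
have [Tt|Tt] := pselect (T i t); last by rewrite (keep Tt); exact: IH.
have /choice[gm Hgm] : forall u, exists gm : (R -> R) * (R -> R),
    e i u -> msg u i (J (tau u i t) u i) gm.1 gm.2.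
  move=> u; have [eiu|_] := boolP (e i u); last by exists (cst 0, cst 0).
  have eui : e u i by rewrite e_sym.
  have [|g [m H]] := IH (tau u i t) _ u i eui; last by exists (g, m).
  by rewrite ltnS; exact: tau_causal.
have [g' [_ Hg']] := updated_message e_simple f12 F_dom eij Hgm (upd Tt).
by exists g', (cst 0).
Qed.

(** One round with trivial [A]: an update removes [m] whatever regular messages it reads. *)
Lemma messages_eventually_clean : exists N, forall t, (N <= t)%N ->
  forall i j, e i j -> exists g, msg i j (J t i j) g (cst 0).
Proof.
apply: (eventually_updated e_sym T_total (A := fun _ _ _ => True)
  (B := fun t i j => exists g, msg i j (J t i j) g (cst 0))).
- move=> t i j eij Tt _; have [upd _] := J_alg t eij.
  have /choice[gm Hgm] : forall u, exists gm : (R -> R) * (R -> R),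
      e i u -> msg u i (J (tau u i t) u i) gm.1 gm.2.
    move=> u; have [eiu|_] := boolP (e i u); last by exists (cst 0, cst 0).
    have eui : e u i by rewrite e_sym.
    by have [g [m H]] := messages_regular (tau u i t) eui; exists (g, m).
  have [g' [_ Hg']] := updated_message e_simple f12 F_dom eij Hgm (upd Tt).
  by exists g'.
- by move=> t i j eij Tt; have [_ ->] := J_alg t eij.
- by exists 0%N.
Qed.

Lemma estimate_exists t i : exists y, unique_minimizer (belief e f1 (J t) i) y.
Proof.
have /choice[gm Hgm] : forall u, exists gm : (R -> R) * (R -> R),
    e i u -> msg u i (J t u i) gm.1 gm.2.
  move=> u; have [eiu|_] := boolP (e i u); last by exists (cst 0, cst 0).
  have eui : e u i by rewrite e_sym.
  by have [g [m H]] := messages_regular t eui; exists (g, m).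
have [y [_ Hy]] := node_minimizer_exists e_simple f12 F_dom Hgm.
by exists y.
Qed.

Variable xs : 'rV[R]_n.
Hypothesis xs_crit : forall i, gradient e f1 f2 i xs = 0.

Let q := (1 + lambda) / 2.
Let lambda01 : 0 < lambda < 1. Proof. by have [] := F_dom. Qed.
Let lambda_lt_q : lambda < q. Proof. by case/andP: lambda01 => *; rewrite /q; lra. Qed.
Let q_lt1 : q < 1. Proof. by case/andP: lambda01 => *; rewrite /q; lra. Qed.

Local Notation near_xs := (near_opt f2 lambda w xs q).

Lemma messages_update_near eps t i j : 0 <= eps -> e i j -> T i t ->
  (forall u, e i u -> near_xs eps u i (J (tau u i t) u i)) ->
  near_xs (q * eps) i j (J t.+1 i j).
Proof.
move=> eps0 eij Tt H; have [upd _] := J_alg t eij.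
exact: (near_opt_update e_simple f12 F_dom xs_crit lambda_lt_q q_lt1 eps0 eij H
  (upd Tt)).
Qed.

(** Starts the contraction: an [eps] valid on a finite time window persists, since updates do not
    increase it. *)
Lemma messages_eventually_near : exists2 eps, 0 <= eps &
  exists N, forall t, (N <= t)%N -> forall i j, e i j -> near_xs eps i j (J t i j).
Proof.
have [ta Hta] := messages_eventually_clean.
have [tb Htb] := delays_unbounded T_total ta.
(* Finitely many messages have times from [ta] to [maxn ta tb], so one [eps] serves all. *)
have [eps eps0 Heps] : exists2 eps, 0 <= eps &
    forall tij : 'I_(maxn ta tb).+1 * 'I_n * 'I_n,
    (ta <= tij.1.1)%N -> e tij.1.2 tij.2 ->
    near_xs eps tij.1.2 tij.2 (J tij.1.1 tij.1.2 tij.2).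
  apply: uniform_bound => [[[t i] j] /= r r' rr' H tat eij|[[t i] j] /=].
    exact: (near_optW F_dom rr' (H tat eij)).
  have [tat|tat] := boolP (ta <= t)%N; last by exists 0.
  have [eij|eij] := boolP (e i j); last by exists 0.
  have [g Hg] := Hta _ tat _ _ eij.
  by have [r r0 Hr] := near_opt_exists F_dom xs lambda_lt_q Hg; exists r.
exists eps => //; exists ta; elim/ltn_ind => t IH tat i j eij.
have [tab|] := leqP t (maxn ta tb).
  have tab' : (t < (maxn ta tb).+1)%N by rewrite ltnS.
  exact: (Heps (Ordinal tab', i, j)).
(* From [tb] on, an update reads only messages of times at least [ta], covered by the induction
   hypothesis. *)
case: t IH tat => // t IH tat; rewrite ltnS geq_max => /andP[tat' tbt].
have [_ keep] := J_alg t eij.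
have [Tt|Tt] := pselect (T i t); last by rewrite keep //; exact: IH.
have := @messages_update_near eps t i j eps0 eij Tt.
have qe : q * eps <= eps by rewrite ler_piMl// ltW.
move=> H; apply: (near_optW F_dom qe); apply: H => u eiu; apply: IH.
- by rewrite ltnS; apply: tau_causal; rewrite e_sym.
- exact: Htb.
- by rewrite e_sym.
Qed.

Lemma messages_converge : exists2 eps, 0 <= eps & forall k, exists N,
  forall t, (N <= t)%N -> forall i j, e i j -> near_xs (q ^+ k * eps) i j (J t i j).
Proof.
have [eps eps0 H0] := messages_eventually_near; exists eps => //.
have q0 : 0 < q by case/andP: lambda01 => + _; move/lt_trans; apply.
elim=> [|k IH]; first by rewrite expr0 mul1r.
apply: (eventually_updated e_sym T_total
  (A := fun t i j => near_xs (q ^+ k * eps) i j (J t i j))).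
- move=> t i j eij Tt H; rewrite exprS -mulrA.
  by apply: messages_update_near => //; rewrite mulr_ge0// exprn_ge0// ltW.
- by move=> t i j eij Tt; have [_ ->] := J_alg t eij.
- by have [N HN] := IH; exists N => t Nt i j; exact: HN.
Qed.

Lemma estimates_converge (x : nat -> 'rV[R]_n) :
  (forall t i, (0 < t)%N -> unique_minimizer (belief e f1 (J t) i) (x t ord0 i)) ->
  x t @[t --> \oo] --> xs.
Proof.
move=> Hx; have [eps eps0 H] := messages_converge.
have [_ w_gt0 _] := F_dom; have [l0 l1] := andP lambda01.
have q0 : 0 < q by exact: lt_trans lambda_lt_q.
apply/cvgrPdist_le => d d0.
(* Bounds [w_i * lambda * eps] for all [i] at once; the summand 1 makes it a legitimate divisor. *)
pose C := `|w| * (lambda * eps) + 1.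
have C0 : 0 < C by rewrite /C ltr_wpDl// !mulr_ge0// ltW.
have [k Hk] : exists k, q ^+ k * C <= d.
  have : (fun k => q ^+ k : R) @ \oo --> (0 : R).
    by apply: cvg_expr; rewrite gtr0_norm.
  move=> /cvgrPdist_lt/(_ _ (divr_gt0 d0 C0))[k _ Hk]; exists k.
  have := Hk k (leqnn k); rewrite /= sub0r normrN gtr0_norm ?exprn_gt0//.
  by rewrite ltr_pdivlMr// => /ltW.
have [N HN] := H k.
(* The successor ensures [0 < t], as [Hx] demands. *)
exists N.+1 => // t /= Nt; apply: rV_norm_le => [|i]; first exact: ltW.
rewrite !mxE distrC.
have e0 : 0 <= q ^+ k * eps by rewrite mulr_ge0// exprn_ge0// ltW.
have Hb := Hx t i (leq_ltn_trans (leq0n N) Nt).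
have := near_opt_belief e_simple f12 F_dom xs_crit lambda_lt_q q_lt1 e0 _ Hb.
move=> /(_ _)/le_trans; apply.
  by move=> u eiu; apply: HN; [exact: ltnW|rewrite e_sym].
apply: le_trans Hk.
have -> : w ord0 i * (lambda * (q ^+ k * eps)) = q ^+ k * (w ord0 i * (lambda * eps)).
  by ring.
rewrite ler_pM2l ?exprn_gt0//.
have := rV_norm_ge w i; rewrite gtr0_norm// => wi.
apply: (@le_trans _ _ (`|w| * (lambda * eps))); last by rewrite /C lerDl.
by rewrite ler_wpM2r// mulr_ge0// ltW.
Qed.

End Convergence.

(* The conclusion treats x^(t) and x^* as definite descriptions: they exist as
   unique minimizers (of the beliefs for t > 0, and of the objective), and
   x^(t) converges to x^*.  The value [x 0] plays no role. *)
Theorem mainTheorem3 (R : realType) (n : nat) (e : rel 'I_n)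
    (f1 : 'I_n -> R -> R) (f2 : 'I_n -> 'I_n -> R * R -> R)
    (lambda : R) (w : 'rV[R]_n)
    (T : 'I_n -> set nat) (tau : 'I_n -> 'I_n -> nat -> nat)
    (kappa : nat -> 'I_n -> 'I_n -> R)
    (J : nat -> 'I_n -> 'I_n -> R -> R) :
  simple_graph e ->
  pairwise_separable_convex e f1 f2 ->
  scaled_diagonally_dominant lambda w (objective e f1 f2) ->
  initialization e f2 (J 0%N) ->
  delays_causal e tau ->
  async_min_sum e f1 f2 T tau kappa J ->
  totally_asynchronous e T tau ->
  exists (x : nat -> 'rV[R]_n) (xstar : 'rV[R]_n),
    [/\ forall t i, (0 < t)%N ->
          unique_minimizer (belief e f1 (J t) i) (x t ord0 i),
        unique_minimizer (objective e f1 f2) xstar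
      & x t @[t --> \oo] --> xstar].
Proof.
move=> eS f12 Fd J0 tc Ja Tt.
have [l01 w0 _] := Fd.
have [xs xs0] := critical_point_exists l01 w0 (is_derive_gradient eS f12)
  (gradient_continuous eS f12) (hessian_curvature eS f12)
  (fun i x => hessian_dominant eS f12 i x Fd).
have /choice[x Hx] : forall ti : nat * 'I_n,
    exists y, unique_minimizer (belief e f1 (J ti.1) ti.2) y.
  by move=> [t i]; exact: (estimate_exists eS f12 Fd J0 tc Ja).
exists (fun t => \row_i x (t, i)), xs.
have Hb t i : (0 < t)%N -> unique_minimizer (belief e f1 (J t) i)
    ((\row_i x (t, i) : 'rV[R]_n) ord0 i).
  by move=> _; rewrite mxE; exact: (Hx (t, i)).
split=> //; first exact: critical_point_minimizer.
exact: (estimates_converge eS f12 Fd J0 tc Ja Tt xs0).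
Qed.
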